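(* Let $N\ge3$ and $\zeta=(\zeta_0,\ldots,\zeta_m)\in\mathbb{C}^{m+1}$. Let $t_1=\sum_{i=1}^Nx_i^2\in H_\zeta(\mathfrak{so}_N,V_N)$, where $x_1,\ldots,x_N$ is an orthonormal basis of $V_N$, and let $C\in Z(U(\mathfrak{so}_N))$ be the symmetrization of $$\mathrm{Res}_{z=0}\ g(z^{-2})\det(1+z^2A^2)^{-1/2}z^{-1}dz\in\mathbb{C}[\mathfrak{so}_N]\simeq S(\mathfrak{so}_N),$$ where $g(z)=\sum_{j=1}^{m+1}g_jz^j$ is the polynomial, with coefficients determined by $\zeta$, that is defined in the context. Then the element $t_1':=t_1+C$ is a central element of $H_\zeta(\mathfrak{so}_N,V_N)$.
   Context: The ground field is $\mathbb{C}$. $V_N=\mathbb{C}^N$ with $(x,y)=x^{T}y$; $\mathfrak{so}_N$ is the Lie algebra of skew-symmetric $N\times N$ matrices. Identify $S(\mathfrak{so}_N)\simeq\mathbb{C}[\mathfrak{so}_N]$ by sending $B\in\mathfrak{so}_N$ to the function $A\mapsto\mathrm{tr}(AB)$; ''symmetrization'' is the symmetrization map $S(\mathfrak{so}_N)\to U(\mathfrak{so}_N)$. Define $\gamma_{2j+1}(x,y)\in\mathbb{C}[\mathfrak{so}_N]$ by $(x,A(1+\tau^2A^2)^{-1}y)\det(1+\tau^2A^2)^{-1/2}=\sum_{j\ge0}\gamma_{2j+1}(x,y)(A)\tau^{2j}$, where $\det(1+\tau^2A^2)^{-1/2}$ is the power series in $\tau^2$ with constant term 1, and let $r_{2j+1}(x,y)\in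 U(\mathfrak{so}_N)$ be the symmetrization of $\gamma_{2j+1}(x,y)$. The algebra $H_\zeta(\mathfrak{so}_N,V_N)$ is generated by $U(\mathfrak{so}_N)$ and $V_N$ with relations $[A,x]=A(x)$ and $[x,y]=\sum_{j=0}^m\zeta_jr_{2j+1}(x,y)$ for $A\in\mathfrak{so}_N$, $x,y\in V_N$. Constants: $\omega_s=\dfrac{\pi^{1/2}(s+N-1)!}{2^{s+N+1}}$, $\mu_s=\pi^{N-\frac12}(s+1)!\,\omega_s^{-1}$, $\nu_s=-\dfrac{\mu_s}{s+1}$. Given $\{\zeta_j\}_{j=0}^m$, the sequence $\{a_j\}_{j=0}^m$ is defined recursively (in decreasing order of $j$) by $$\zeta_j=2\nu_{2j+1}\sum_{l=1}^{m+1-j}(-1)^{l+1}\binom{2j+2l}{2l-1}a_{j+l-1},\qquad 0\le j\le m,$$ and $\{g_j\}_{j=1}^{m+1}$ is defined by $$g_j=2\mu_{2j-1}\Big(-2a_{j-1}+\sum_{l=1}^{m+1-j}(-1)^{l+1}\binom{2j+2l}{2l}a_{j+l-1}\Big).$$ $\mathrm{Res}_{z=0}f(z)dz$ denotes the coefficient of $z^{-1}$ in $f$. *)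

(* Defs.v *)
From HB Require Import structures.
From mathcomp Require Import all_boot all_order all_algebra perm.
From mathcomp Require Import generic_quotient ring_quotient.
From mathcomp Require Import boolp reals.
From mathcomp Require Import complex.
From mathcomp Require Import monalg mpoly.
From mathcomp Require Import ring zify.
From mathcomp Require trigo exp.

Set Implicit Arguments.
Unset Strict Implicit.
Unset Printing Implicit Defensive.

Import Order.TTheory GRing.Theory Num.Theory.
Local Open Scope ring_scope.
Local Open Scope quotient_scope.

Definition is_central (A : pzRingType) (a : A) : Prop :=
  forall b : A, a * b = b * a.

(* [{fmonom X}] is the free monoid on [X], so that [freeAlg F X] is the free
   associative unital algebra. *)
Notation freeAlg F X := {malg F[{fmonom X}]}.

Section Presentation.
Variables (F : fieldType) (X : choiceType).
Implicit Types (p q a b : freeAlg F X).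

Definition fgen (x : X) : freeAlg F X := << fmu x >>.

Variable rel : freeAlg F X -> Prop.

Inductive tsideal : freeAlg F X -> Prop :=
| tsideal0 : tsideal 0
| tsidealD a p b q : rel p -> tsideal q -> tsideal (a * p * b + q).

Lemma freeAlg_scalerAr (c : F) p q : c *: (p * q) = p * (c *: q).
Proof.
have [z zZ zC] : exists2 z, forall r, z * r = c *: r & z * p = p * z.
  exists (mkmalgU (@mone {fmonom X}) c); first exact: mul_malgC.
  rewrite [p]monalgE mulr_suml mulr_sumr; apply: eq_bigr => k _.
  by rewrite !malgM_def !fgmulUU mulrC Monoid.mul1m Monoid.mulm1.
apply: etrans (esym (zZ _)) _.
apply: etrans (mulrA z p q) _.
apply: etrans (congr1 (fun r => r * q) zC) _.
apply: etrans (esym (mulrA p z q)) _.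
exact: (congr1 (GRing.mul p) (zZ q)).
Qed.

Lemma tsideal_rel p : rel p -> tsideal p.
Proof.
by move=> rp; have := tsidealD 1 1 rp tsideal0; rewrite mul1r mulr1 addr0.
Qed.

Lemma tsideal_add p q : tsideal p -> tsideal q -> tsideal (p + q).
Proof.
move=> Ip Iq; elim: Ip => [|a r b s rr _ IH]; first by rewrite add0r.
by rewrite -addrA; apply: tsidealD.
Qed.

Lemma tsideal_mull a p : tsideal p -> tsideal (a * p).
Proof.
elim=> [|b r c s rr _ IH]; first by rewrite mulr0; apply: tsideal0.
by rewrite mulrDr !mulrA; apply: tsidealD.
Qed.

Lemma tsideal_mulr a p : tsideal p -> tsideal (p * a).
Proof.
elim=> [|b r c s rr _ IH]; first by rewrite mul0r; apply: tsideal0.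
by rewrite mulrDl -(mulrA (b * r)); apply: tsidealD.
Qed.

Definition tsideal_pred : {pred freeAlg F X} := fun p => `[< tsideal p >].

Fact tsideal_zmod_closed : zmod_closed tsideal_pred.
Proof.
split; first by apply/asboolP; apply: tsideal0.
move=> p q /asboolP Ip /asboolP Iq; apply/asboolP; apply: tsideal_add => //.
by rewrite -mulN1r; apply: tsideal_mull.
Qed.

HB.instance Definition _ :=
  GRing.isZmodClosed.Build (freeAlg F X) tsideal_pred tsideal_zmod_closed.

Definition presAlg : Type := @Quotient.quot (freeAlg F X) tsideal_pred.

HB.instance Definition _ := Choice.on presAlg.
HB.instance Definition _ := GRing.Zmodule.on presAlg.
HB.instance Definition _ := EqQuotient.on presAlg.

End Presentation.

(* Sealing these operations keeps unification from unfolding the quotient. *)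
HB.lock Definition presAlg_pi (F : fieldType) (X : choiceType)
  (rel : freeAlg F X -> Prop) (p : freeAlg F X) : presAlg rel :=
  \pi_(presAlg rel) p.

HB.lock Definition pmul (F : fieldType) (X : choiceType)
  (rel : freeAlg F X -> Prop) (u v : presAlg rel) : presAlg rel :=
  presAlg_pi rel (repr u * repr v).

HB.lock Definition pscale (F : fieldType) (X : choiceType)
  (rel : freeAlg F X -> Prop) (c : F) (u : presAlg rel) : presAlg rel :=
  presAlg_pi rel (c *: repr u).

Section PresentationTheory.
Variables (F : fieldType) (X : choiceType) (rel : freeAlg F X -> Prop).
Local Notation presAlg := (presAlg rel).
Local Notation presAlg_pi := (presAlg_pi rel).
Local Notation tsideal := (tsideal rel).
Local Notation pmul := (@pmul.body F X rel).
Local Notation pscale := (@pscale.body F X rel).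
Implicit Types (p q : freeAlg F X).

Definition pgen (x : X) : presAlg := presAlg_pi (fgen F x).

Lemma presAlg_eqP p q : reflect (presAlg_pi p = presAlg_pi q) (`[< tsideal (p - q) >]).
Proof.
by apply: (iffP idP) => [H|/eqP]; [apply/eqP|]; rewrite presAlg_pi.unlock -Quotient.idealrBE.
Qed.

Lemma presAlg_eq p q : tsideal (p - q) -> presAlg_pi p = presAlg_pi q.
Proof. by move=> H; apply/presAlg_eqP/asboolP. Qed.

Lemma presAlg_reprP p : tsideal (repr (presAlg_pi p) - p).
Proof. by apply/asboolP/presAlg_eqP; rewrite presAlg_pi.unlock reprK. Qed.

Lemma presAlg_ind (P : presAlg -> Prop) :
  (forall p, P (presAlg_pi p)) -> forall u, P u.
Proof.
by move=> H u; have := H (repr u); rewrite presAlg_pi.unlock reprK.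
Qed.

Lemma presAlg_piD p q : presAlg_pi (p + q) = presAlg_pi p + presAlg_pi q.
Proof. by rewrite presAlg_pi.unlock !piE. Qed.

Lemma presAlg_piM p q : presAlg_pi (p * q) = pmul (presAlg_pi p) (presAlg_pi q).
Proof.
rewrite pmul.unlock; apply/esym/presAlg_eq; set p' := repr _; set q' := repr _.
have -> : p' * q' - p * q = p' * (q' - q) + (p' - p) * q.
  by rewrite mulrBr mulrBl addrA subrK.
by apply: tsideal_add; [apply: tsideal_mull|apply: tsideal_mulr];
  apply: presAlg_reprP.
Qed.

Lemma presAlg_piZ c p : presAlg_pi (c *: p) = pscale c (presAlg_pi p).
Proof.
rewrite pscale.unlock; apply/esym/presAlg_eq; rewrite -scalerBr -mul_malgC.
by apply/tsideal_mull/presAlg_reprP.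
Qed.

Fact pmulA : associative pmul.
Proof.
elim/presAlg_ind=> p; elim/presAlg_ind=> q; elim/presAlg_ind=> r.
by rewrite -!presAlg_piM mulrA.
Qed.
Fact pmul1l : left_id (presAlg_pi 1) pmul.
Proof. by elim/presAlg_ind=> p; rewrite -presAlg_piM mul1r. Qed.
Fact pmul1r : right_id (presAlg_pi 1) pmul.
Proof. by elim/presAlg_ind=> p; rewrite -presAlg_piM mulr1. Qed.
Fact pmulDl : left_distributive pmul +%R.
Proof.
elim/presAlg_ind=> p; elim/presAlg_ind=> q; elim/presAlg_ind=> r.
by rewrite -!(presAlg_piM, presAlg_piD) mulrDl.
Qed.
Fact pmulDr : right_distributive pmul +%R.
Proof.
elim/presAlg_ind=> p; elim/presAlg_ind=> q; elim/presAlg_ind=> r.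
by rewrite -!(presAlg_piM, presAlg_piD) mulrDr.
Qed.

HB.instance Definition _ :=
  GRing.Zmodule_isPzRing.Build presAlg pmulA pmul1l pmul1r pmulDl pmulDr.

Fact pscaleA c d u : pscale c (pscale d u) = pscale (c * d) u.
Proof. by elim/presAlg_ind: u => p; rewrite -!presAlg_piZ scalerA. Qed.
Fact pscale1 : left_id 1 pscale.
Proof. by elim/presAlg_ind=> p; rewrite -presAlg_piZ scale1r. Qed.
Fact pscaleDr : right_distributive pscale +%R.
Proof.
move=> c; elim/presAlg_ind=> p; elim/presAlg_ind=> q.
by rewrite -!(presAlg_piZ, presAlg_piD) scalerDr.
Qed.
Fact pscaleDl u : {morph pscale^~ u : c d / c + d}.
Proof.
move=> c d; elim/presAlg_ind: u => p.
by rewrite -!(presAlg_piZ, presAlg_piD) scalerDl.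
Qed.

HB.instance Definition _ :=
  GRing.Zmodule_isLmodule.Build F presAlg pscaleA pscale1 pscaleDr pscaleDl.

Lemma presAlg_pi_is_monoid_morphism : monoid_morphism presAlg_pi.
Proof. by split=> // p q; apply: presAlg_piM. Qed.

Lemma presAlg_pi_is_linear : linear presAlg_pi.
Proof. by move=> c p q; rewrite presAlg_piD presAlg_piZ. Qed.

HB.instance Definition _ := GRing.isLinear.Build F (freeAlg F X) presAlg *:%R
  presAlg_pi presAlg_pi_is_linear.
HB.instance Definition _ := GRing.isMonoidMorphism.Build (freeAlg F X) presAlg
  presAlg_pi presAlg_pi_is_monoid_morphism.

(* MathComp's [algType] requires 1 != 0, which is not known for an arbitrary
   presentation; the algebra axioms are therefore given as plain lemmas. *)
Lemma presAlg_scalerAl (c : F) (u v : presAlg) : c *: (u * v) = (c *: u) * v.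
Proof.
elim/presAlg_ind: u => p; elim/presAlg_ind: v => q.
by rewrite -rmorphM -!linearZ -rmorphM scalerAl.
Qed.

Lemma presAlg_scalerAr (c : F) (u v : presAlg) : c *: (u * v) = u * (c *: v).
Proof.
elim/presAlg_ind: u => p; elim/presAlg_ind: v => q.
by rewrite -rmorphM -!linearZ -rmorphM freeAlg_scalerAr.
Qed.

End PresentationTheory.

Section Orthogonal.
Variables (F : numFieldType) (N : nat).

Definition skew_pred : {pred 'M[F]_N} := fun A => A^T == - A.

Fact skew_submod_closed : submod_closed skew_pred.
Proof.
split=> [|c A B /eqP skA /eqP skB]; first by rewrite unfold_in trmx0 oppr0.
by rewrite unfold_in linearD linearZ /= skA skB scalerN opprD.
Qed.

HB.instance Definition _ :=
  GRing.isSubmodClosed.Build F 'M[F]_N skew_pred skew_submod_closed.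

Record so := So { so_mx :> 'M[F]_N; so_skew : so_mx \in skew_pred }.

HB.instance Definition _ := [isSub for so_mx].
HB.instance Definition _ := [Choice of so by <:].
HB.instance Definition _ := [SubChoice_isSubZmodule of so by <:].
HB.instance Definition _ := [SubZmodule_isSubLmodule of so by <:].

Lemma soP (A : so) : A^T = - A :> 'M[F]_N.
Proof. exact/eqP/so_skew. Qed.

Fact so_bracket_skew (A B : so) : A *m B - B *m A \in skew_pred.
Proof.
rewrite unfold_in linearB /= !trmx_mul !soP.
by rewrite !(mulNmx, mulmxN) !opprK opprB.
Qed.

Definition so_bracket (A B : so) : so := So (so_bracket_skew A B).

Inductive U_rel : freeAlg F so -> Prop :=
| U_rel_lin (c : F) (A B : so) :
    U_rel (fgen F (c *: A + B) - (c *: fgen F A + fgen F B))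
| U_rel_bracket (A B : so) :
    U_rel (fgen F A * fgen F B - fgen F B * fgen F A - fgen F (so_bracket A B)).

Definition Uso := presAlg U_rel.
HB.instance Definition _ := GRing.PzRing.on Uso.
HB.instance Definition _ := GRing.Lmodule.on Uso.

Definition so_to_U (A : so) : Uso := pgen U_rel A.

(* S(so_N), identified with C[so_N], is the polynomial ring on the basis
   L_{ij} = E_{ij} - E_{ji} (i < j) of so_N.  Under the identification of B
   with the function A |-> tr(AB), the variable 'X_k is the function
   A |-> tr(A (so_basis k)). *)
Definition so_index := {p : 'I_N * 'I_N | (p.1 < p.2)%N}.
Definition so_dim := #|{: so_index}|.
Definition Sso := {mpoly F[so_dim]}.

Fact so_basis_skew (i j : 'I_N) :
  delta_mx i j - delta_mx j i \in skew_pred.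
Proof. by rewrite unfold_in linearB /= !trmx_delta opprB. Qed.

Definition so_basis (k : 'I_so_dim) : so :=
  let p := val (enum_val k : so_index) in So (so_basis_skew p.1 p.2).

Definition Sso_eval (f : Sso) (A : so) : F :=
  f.@[fun k => \tr (A *m so_basis k)].

(* The tautological matrix A with entries in C[so_N]; the coefficient -1/2 comes
   from tr(L_{ij} L_{ij}) = -2. *)
Definition so_generic : 'M[Sso]_N :=
  \sum_(k < so_dim) (- 2^-1 *: 'X_k) *: map_mx (@mpolyC so_dim F) (so_basis k).

Lemma so_genericE (A : so) (i j : 'I_N) : Sso_eval (so_generic i j) A = A i j.
Proof.
rewrite /Sso_eval /so_generic summxE raddf_sum /=.
pose G (p : 'I_N * 'I_N) := A p.1 p.2 *
  ((i == p.1)%:R * (j == p.2)%:R - (i == p.2)%:R * (j == p.1)%:R).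
have tr_delta a b : \tr (A *m delta_mx a b) = A b a.
  rewrite mxtrace_mulC /mxtrace (bigD1 a) //= big1 => [|k ka].
    rewrite addr0 mxE (bigD1 b) //= big1 => [|k kb].
      by rewrite mxE !eqxx mul1r addr0.
    by rewrite mxE (negPf kb) andbF mul0r.
  by rewrite mxE big1 // => l _; rewrite mxE (negPf ka) mul0r.
have skE a b : A a b = - A b a.
  by have /matrixP/(_ b a) := soP A; rewrite !mxE.
transitivity (\sum_(k < so_dim) G (val (enum_val k : so_index))).
  apply: eq_bigr => k _; rewrite !mxE /= mevalM mevalZ mevalXU mevalC /G /=.
  set p := val (enum_val k); rewrite mulmxBr linearB /= !tr_delta.
  by rewrite [A p.2 _]skE -!mulnb !natrM; field.
rewrite -(big_enum_val (fun q : so_index => G (val q))) /=.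
transitivity (\sum_(p : 'I_N * 'I_N | (p.1 < p.2)%N) G p).
  rewrite [RHS](reindex_omap (val : so_index -> 'I_N * 'I_N) insub) /=.
    by apply: eq_bigl => -[p hp] /=; rewrite hp insubT /= eqxx.
  by move=> p hp; rewrite insubT.
have Gsum (H : 'I_N * 'I_N -> F) (p : 'I_N * 'I_N) : (forall q : 'I_N * 'I_N, q.1 < q.2 -> (q != p)%R -> (H q = 0)%R)%N ->
   \sum_(q : 'I_N * 'I_N | (q.1 < q.2)%N) H q = if (p.1 < p.2)%N then H p else 0.
  move=> Hq; case: ifP => hp.
    by rewrite (bigD1 p) //= big1 ?addr0 // => q /andP[]; apply: Hq.
  by apply: big1 => q q12; apply: Hq => //; apply: contraFneq hp => <-.
have G0 p : p != (i, j) -> p != (j, i) -> G p = 0.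
  case: p => a b; rewrite /G /= !xpair_eqE => ab ba; rewrite -!natrM !mulnb.
  rewrite (eq_sym i a) (eq_sym j b) (negPf ab) (eq_sym i b) (eq_sym j a).
  rewrite andbC (negPf ba).
  by rewrite subrr mulr0.
case: (ltngtP i j) => [ij|ji|/val_inj eij].
- rewrite (Gsum _ (i, j)) /= ?ij.
    rewrite /G /= !eqxx; have -> : (i == j) = false by rewrite -val_eqE /= ltn_eqF.
    by rewrite mulr1 mul0r subr0 mulr1.
  move=> q q12 qij; apply: G0 => //; apply: contraTneq q12 => ->.
  by rewrite /= -leqNgt ltnW.
- rewrite (Gsum _ (j, i)) /= ?ji.
    rewrite /G /= !eqxx; have -> : (i == j) = false by rewrite -val_eqE /= gtn_eqF.
    by rewrite mul0r mulr1 sub0r mulrN1 -skE.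
  move=> q q12 qij; apply: G0 => //; apply: contraTneq q12 => ->.
  by rewrite /= -leqNgt ltnW.
- have /eqP := skE i j; rewrite eij -addr_eq0 -mulr2n mulrn_eq0 /= => /eqP->.
  apply: big1 => p p12; rewrite /G eij (mulrC (j == p.1)%:R) subrr mulr0 //.
Qed.

Definition symm_prod (s : seq so) : Uso :=
  (size s)`!%:R^-1 *:
    \sum_(sigma : 'S_(size s)) \prod_(k < size s) so_to_U s`_(sigma k).

(* [m2s m] lists the variables of the monomial [m] with multiplicity. *)
Definition symmetrization (f : Sso) : Uso :=
  \sum_(m <- msupp f) f@_m *: symm_prod (map so_basis (m2s m)).

(* Truncations at order n of the power series p^(-1/2), for p(0) = 1,
   obtained by solving q^2 p = 1 degree by degree. *)
Fixpoint invsqrt_trunc (p : {poly Sso}) (n : nat) : {poly Sso} :=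
  if n is n'.+1 then
    let q := invsqrt_trunc p n' in
    q - (2^-1 *: (q ^+ 2 * p)`_n : Sso) *: 'X^n
  else 1.

Definition invsqrt_coef (p : {poly Sso}) (n : nat) : Sso := (invsqrt_trunc p n)`_n.

Lemma invsqrt_truncE (p : {poly Sso}) n :
  invsqrt_trunc p n = \poly_(i < n.+1) invsqrt_coef p i.
Proof.
elim: n => [|n IH]; apply/polyP => k; rewrite coef_poly.
  rewrite /invsqrt_coef /= !coef1 ltnS leqn0; by case: k => [|k] //; rewrite coef1.
rewrite ltnS leq_eqVlt; case: eqVneq => [->|kn] //=.
rewrite coefB coefZ coefXn (negPf kn) mulr0 subr0 [in LHS]IH coef_poly.
by rewrite ltnS.
Qed.

Lemma invsqrt_trunc_correct (p : {poly Sso}) n k : p`_0 = 1 -> (k <= n)%N ->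
  (invsqrt_trunc p n ^+ 2 * p)`_k = (k == 0%N)%:R.
Proof.
move=> p0; elim: n k => [|n IH] k.
  by rewrite leqn0 => /eqP->; rewrite /= expr1n mul1r.
rewrite leq_eqVlt /=; set q := invsqrt_trunc p n; set e : Sso := 2^-1 *: _.
have q0 : q`_0 = 1.
  rewrite /q; elim: {IH q e k} n => [|n IH] /=; first by rewrite coef1.
  by rewrite coefB IH coefZ coefXn mulr0 subr0.
have -> : (q - e *: 'X^(n.+1)) ^+ 2 * p =
  q ^+ 2 * p - ((e *: (q * p)) *+ 2 - e ^+ 2 *: (p * 'X^(n.+1))) * 'X^(n.+1).
  rewrite -!mul_polyC; ring.
rewrite coefB coefMXn.
case: ltnP => [kn|nk].
  rewrite subr0 => H; apply: IH; by [].
case: eqVneq => // -> _.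
rewrite subnn coefB coefMn !coefZ coefMXn /= mulr0 subr0 coef0M q0 p0 !mulr1.
suff -> : e *+ 2 = (q ^+ 2 * p)`_n.+1 by rewrite subrr.
by rewrite /e -scaler_nat scalerA divff ?pnatr_eq0 // scale1r.
Qed.

(* det (1 + u A^2), where u stands for tau^2. *)
Definition det1A2 : {poly Sso} :=
  \det (1%:M + 'X *: map_mx polyC (so_generic *m so_generic)).

Lemma det1A2_0 : det1A2`_0 = 1.
Proof.
rewrite -horner_coef0 /det1A2 -[LHS]/(horner_eval 0 _) -det_map_mx.
set M := map_mx _ _; suff -> : M = 1%:M by rewrite det1.
apply/matrixP => i j; rewrite !mxE rmorphD rmorphM rmorph_nat /= {1}/horner_eval.
by rewrite hornerX mul0r addr0.
Qed.

(* The coefficient of tau^(2 k) in det (1 + tau^2 A^2)^(-1/2). *)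
Definition det_coef (k : nat) : Sso := invsqrt_coef det1A2 k.

(* [so_gamma j x y] is gamma_{2j+1}(x, y): the Cauchy product of
   A (1 + tau^2 A^2)^(-1) = \sum_k (-1)^k A^(2k+1) tau^(2k) with the
   series [det_coef]. *)
Definition so_gamma (j : nat) (x y : 'cV[F]_N) : Sso :=
  \sum_(k < j.+1)
    (-1) ^+ k * ((map_mx (@mpolyC so_dim F) x)^T *m so_generic ^+ (2 * k + 1)
                  *m map_mx (@mpolyC so_dim F) y) 0 0 * det_coef (j - k).

(* [so_r j x y] is r_{2j+1}(x, y). *)
Definition so_r (j : nat) (x y : 'cV[F]_N) : Uso := symmetrization (so_gamma j x y).

(* The coefficient of z^(-1) in g(z^(-2)) det (1 + z^2 A^2)^(-1/2) z^(-1), that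
   is, the constant coefficient of g(z^(-2)) det (1 + z^2 A^2)^(-1/2). *)
Definition residue (g : {poly F}) : Sso :=
  \sum_(j < size g) g`_j *: det_coef j.

Section Hecke.
Variables (m : nat) (zeta : m.+1.-tuple F).

Definition Hgen := (Uso + 'cV[F]_N)%type.
Local Notation u_ u := (fgen F (inl u : Hgen)).
Local Notation v_ x := (fgen F (inr x : Hgen)).

(* The first four constructors make the map from U(so_N) a homomorphism of
   unital algebras and the map from V_N linear. *)
Inductive H_rel : freeAlg F Hgen -> Prop :=
| H_rel_U1 : H_rel (u_ 1 - 1)
| H_rel_UM (u v : Uso) : H_rel (u_ (u * v) - u_ u * u_ v)
| H_rel_Ulin (c : F) (u v : Uso) : H_rel (u_ (c *: u + v) - (c *: u_ u + u_ v))
| H_rel_Vlin (c : F) (x y : 'cV[F]_N) :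
    H_rel (v_ (c *: x + y) - (c *: v_ x + v_ y))
| H_rel_act (A : so) (x : 'cV[F]_N) :
    H_rel (u_ (so_to_U A) * v_ x - v_ x * u_ (so_to_U A) - v_ (A *m x))
| H_rel_comm (x y : 'cV[F]_N) :
    H_rel (v_ x * v_ y - v_ y * v_ x - u_ (\sum_(j < m.+1) zeta`_j *: so_r j x y)).

Definition Hso := presAlg H_rel.
HB.instance Definition _ := GRing.PzRing.on Hso.
HB.instance Definition _ := GRing.Lmodule.on Hso.

Definition U_to_H (u : Uso) : Hso := pgen H_rel (inl u).
Definition V_to_H (x : 'cV[F]_N) : Hso := pgen H_rel (inr x).

End Hecke.

End Orthogonal.

Definition orthonormal_family (F : numFieldType) (N : nat) (x : 'I_N -> 'cV[F]_N) : Prop :=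
  forall i j, ((x i)^T *m x j) 0 0 = (i == j)%:R.

Section Constants.
Variables (R : realType) (N : nat).
Local Notation pi := (trigo.pi : R).
Local Notation C := (R[i]).

Definition const_omega (s : nat) : R :=
  exp.powR pi 2^-1 * (s + N - 1)`!%:R / 2 ^+ (s + N + 1).

Definition const_mu (s : nat) : R :=
  exp.powR pi (N%:R - 2^-1) * (s + 1)`!%:R * (const_omega s)^-1.

Definition const_nu (s : nat) : R := - const_mu s / (s + 1)%:R.

Lemma const_nu_neq0 s : const_nu s != 0.
Proof.
rewrite /const_nu /const_mu /const_omega.
have P r : exp.powR trigo.pi r != 0 :> R by rewrite gt_eqF // exp.powR_gt0 // trigo.pi_gt0.
by rewrite !(mulf_neq0, invr_neq0, oppr_eq0, P, expf_neq0, pnatr_eq0) // -lt0n ?fact_gt0 // addn1.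
Qed.
Section Sequences.
Variables (m : nat) (zeta : m.+1.-tuple C).

(* The list [a_{m+1-k}; ...; a_m]: each step solves the equation for zeta_j,
   j = m - k, for its l = 1 term. *)
Fixpoint a_tail (k : nat) : seq C :=
  if k is k'.+1 then
    let s := a_tail k' in
    let j := (m - k')%N in
    (zeta`_j / (2 * (const_nu (2 * j + 1))%:C)%C
     - \sum_(2 <= l < m.+2 - j)
         (-1) ^+ (l + 1) * 'C(2 * j + 2 * l, 2 * l - 1)%:R * s`_(l - 2))
      / 'C(2 * j + 2, 1)%:R :: s
  else [::].

Definition a_seq (j : nat) : C := (a_tail m.+1)`_j.

Lemma a_tailE k j : (j < k <= m.+1)%N -> (a_tail k)`_j = a_seq (m.+1 - k + j).
Proof.
case/andP=> jk km; rewrite /a_seq.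
have H d : (k + d <= m.+1)%N -> (a_tail (k + d))`_(d + j) = (a_tail k)`_j.
  elim: d => [|d IH]; first by rewrite addn0.
  by rewrite addnS addSn => H; rewrite -IH ?(ltnW H).
by rewrite -(H (m.+1 - k)%N) subnKC.
Qed.

Lemma a_seqP (j : nat) : (j <= m)%N ->
  zeta`_j = 2 * (const_nu (2 * j + 1))%:C%C *
    \sum_(1 <= l < m.+2 - j)
      (-1) ^+ (l + 1) * 'C(2 * j + 2 * l, 2 * l - 1)%:R * a_seq (j + l - 1).
Proof.
move=> jm; rewrite big_ltn; last by rewrite subSn ?ltnS ?subn_gt0 // ltnW.
set T := \sum_(2 <= l < _) _.
have n0 : 2 * (const_nu (2 * j + 1))%:C%C != 0 :> R[i].
  by rewrite mulf_neq0 ?pnatr_eq0 // fmorph_eq0 const_nu_neq0.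
have b0 : 'C(2 * j + 2, 1)%:R != 0 :> R[i] by rewrite bin1 pnatr_eq0 addnS.
have mj : (m - (m - j) = j)%N by rewrite subKn.
have -> : a_seq (j + 1 - 1) =
   (zeta`_j / (2 * (const_nu (2 * j + 1))%:C%C) - T) / 'C(2 * j + 2, 1)%:R.
  rewrite addnK; have := @a_tailE (m - j).+1 0.
  rewrite ltn0Sn ltnS leq_subr addn0 subSS mj => <- //.
  rewrite /= mj; congr ((_ - _) / _); rewrite /T !big_nat.
  apply: eq_bigr => l /andP[l2 lm]; congr (_ * _).
  rewrite a_tailE; last by move: l2 lm jm; clear; lia.
  congr a_seq. lia.
rewrite expr2 mulrNN mul1r (_ : (2 * 1 - 1 = 1)%N) // muln1 mul1r.
by rewrite (mulrC _ (_ / _)) divfK // subrK mulrC divfK.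
Qed.

Definition g_seq (j : nat) : C :=
  2 * (const_mu (2 * j - 1))%:C%C *
    (- 2 * a_seq (j - 1) +
     \sum_(1 <= l < m.+2 - j)
       (-1) ^+ (l + 1) * 'C(2 * j + 2 * l, 2 * l)%:R * a_seq (j + l - 1)).

Definition g_poly : {poly C} := \sum_(1 <= j < m.+2) g_seq j *: 'X^j.

End Sequences.
End Constants.

(* Main.v *)
Require Import Defs.
From HB Require Import structures.
From mathcomp Require Import all_boot all_order all_algebra perm.
From mathcomp Require Import bigenough reals complex.
From mathcomp Require trigo exp.
From mathcomp Require Import monalg.
From mathcomp Require Import ssrcomplements mpoly.
From mathcomp Require Import ring zify.

(** The element [t_1 + C] commutes with so_N because [t_1] and [C] are
invariant; what has to be shown is that it commutes with every vector y.

    Let p, q be independent standard Gaussian vectors in V_N and put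
    B = (p q^T - q p^T)/2, an element of so_N of rank two.  Integration by
    parts shows, as an identity of formal power series with A in so_N,
<<
      E exp(tau (q, A p)) = det (1 + tau^2 A^2)^(-1/2),
      E (x, p) (q, y) exp(tau (q, A p))
        = - tau (x, A (1 + tau^2 A^2)^(-1) y) det (1 + tau^2 A^2)^(-1/2).
>>
    Since (q, A p) = tr(A B) is the linear function attached to B, and since
    symmetrization sends powers of linear functions to powers, the
    symmetrization of the coefficient of tau^(2j) in the determinant series is
    E B^(2j)/(2j)!  and r_(2j+1)(x, y) = - E (x, B y) B^(2j+1)/(2j+1)!  in
    U(so_N) ([symm_det_coef], [so_r_cubature]).  Only polynomials of bounded
    degree occur, so the Gaussian moments are realized by a finite cubature
    formula ([gauss_cubature]) and every expectation is a finite weighted sum,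
    which makes sense in any algebra.

    Summing over an orthonormal basis,
<<
      [t_1, y] = - sum_j zeta_j/(2j+1)! E {B^(2j+1), B y},
      [C, y] = sum_j g_j/(2j)! E [B^(2j), y].
>>
    Left and right multiplication L, R by B commute, and D = L - R satisfies
    D (D^2 + a^2/4) = 0 on V_N, where a is the area spanned by p and q
    ([wedge_cube]).  Expanding in L + R and D gives terms E a^(2i) M_d(B y),
    with M_d = (L + R)^d, and integration by parts removes the factor a^(2i)
    at the price of a quotient of factorials ([gauss_area2_exp]).  So both
    commutators are images, under one linear map sending X^d to a multiple of
    E M_d(B y), of combinations of (X + c)^n +- (X - c)^n with c^2 = -1/4
    ([moment_diff], [moment_sum]).  With P = sum_j a_(j-1) X^(2j), the
    recursions for a_j and g_j say that the polynomial attached to zeta is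
    proportional to P(X + 2c) - P(X - 2c), and the one attached to g to
    P + (P(X + 2c) + P(X - 2c))/2 up to a constant; the two contributions then
    cancel identically ([shift_identity]). *)

Set Implicit Arguments.
Unset Strict Implicit.
Unset Printing Implicit Defensive.

Import Order.TTheory GRing.Theory Num.Theory BigEnough.
Local Open Scope ring_scope.
Local Notation "{ 'mpoly' R [ n ] }" := (mpoly n R) : type_scope.

(** * Gaussian moments and cubature *)

Section LinearExtension.
Variables (n : nat) (R : nzRingType) (V : lmodType R) (G : 'X_{1..n} -> V).

(** The linear map on polynomials that takes the monomial ['X_[m]] to [G m]. *)
Definition monom_lin (p : {mpoly R[n]}) : V := \sum_(m <- msupp p) p@_m *: G m.

Lemma monom_linwE k p : (msize p <= k)%N ->
  monom_lin p = \sum_(m : 'X_{1..n < k}) p@_m *: G m.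
Proof.
move=> le_pk; set I : subFinType _ := 'X_{1..n < k}.
rewrite /monom_lin (big_mksub I) ?msupp_uniq //=; first last.
  by move=> m /msize_mdeg_lt /leq_trans; apply.
by rewrite big_rmcond //= => j /memN_msupp_eq0 ->; rewrite scale0r.
Qed.

Fact monom_lin_is_linear : linear monom_lin.
Proof.
move=> c p q; pose_big_enough k.
  rewrite !(@monom_linwE k) // scaler_sumr -big_split; apply: eq_bigr => m _.
  by rewrite mcoeffD mcoeffZ scalerDl scalerA.
by close.
Qed.
HB.instance Definition _ := GRing.isLinear.Build R {mpoly R[n]} V *:%R monom_lin
  monom_lin_is_linear.

Lemma monom_linX m : monom_lin 'X_[m] = G m.
Proof. by rewrite /monom_lin msuppX big_seq1 mcoeffX eqxx scale1r. Qed.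

End LinearExtension.

Lemma mpoly_linear_ind (n : nat) (R : nzRingType) (P : {mpoly R[n]} -> Prop) :
  (forall c p q, P p -> P q -> P (c *: p + q)) -> (forall m, P 'X_[m]) ->
  forall p, P p.
Proof.
move=> Plin PX p; rewrite [p]mpolyE; elim: (msupp p) => [|m s IH].
  by rewrite big_nil -(subrr 'X_[0%MM]) addrC -scaleN1r; apply: Plin.
by rewrite big_cons; apply: Plin.
Qed.

(** The [k]-th moment of the standard Gaussian law: 0 for odd [k], and
    [(k - 1)!!] for even [k]. *)
Fixpoint gmom (k : nat) : nat :=
  if k is k'.+1 then (if k' is k''.+1 then k' * gmom k'' else 0)%N else 1%N.

Section Gauss.
Variables (M : nat) (R : comNzRingType).

(** The expectation of a polynomial in independent standard Gaussian variables,
    as a linear functional over an arbitrary commutative ring. *)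
Definition gauss (h : {mpoly R[M]}) : R :=
  monom_lin (fun m => (\prod_(i < M) gmom (m i))%:R : R^o) h.

HB.instance Definition _ := GRing.Linear.copy gauss
  (@monom_lin M R R^o (fun m => (\prod_(i < M) gmom (m i))%:R : R^o)).

Lemma gaussX m : gauss 'X_[m] = (\prod_(i < M) gmom (m i))%:R.
Proof. exact: (@monom_linX M R R^o). Qed.

Lemma gaussD : {morph gauss : p q / p + q}. Proof. exact: raddfD. Qed.
Lemma gaussB : {morph gauss : p q / p - q}. Proof. exact: raddfB. Qed.
Lemma gaussZ c p : gauss (c *: p) = c * gauss p.
Proof. exact: linearZ. Qed.
Lemma gauss1 : gauss 1 = 1.
Proof.
by rewrite -mpolyX0 gaussX big1 // => i _; rewrite mnm0E.
Qed.
Lemma gauss_sum I r (P : pred I) F :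
  gauss (\sum_(i <- r | P i) F i) = \sum_(i <- r | P i) gauss (F i).
Proof. exact: raddf_sum. Qed.

(** Gaussian integration by parts; the source of every identity on [gauss]. *)
Lemma gauss_byparts i h : gauss ('X_i * h) = gauss h^`M(i).
Proof.
elim/mpoly_linear_ind: h => [c p q Hp Hq|m].
  by rewrite mulrDr mderivD mderivZ -scalerAr !gaussD !gaussZ Hp Hq.
rewrite -mpolyXD mderivX gaussX gaussZ gaussX -natrM; congr (_%:R).
rewrite (bigD1 i) //= [in RHS](bigD1 i) //= mulnA.
rewrite !mnmDE mnmBE mnm1E eqxx add1n; congr (_ * _)%N; last first.
  apply: eq_bigr => j ji; rewrite mnmDE mnmBE mnm1E eq_sym (negPf ji).
  by rewrite add0n subn0.
by case: (m i) => [|k] //; rewrite subn1.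
Qed.

End Gauss.

Section Cubature.
Variables (K : numFieldType) (n : nat).

(** The one-variable formula with nodes [0, ..., n]: the weights solve a
    Vandermonde system. *)
Lemma gauss_weights : exists w : 'I_n.+1 -> K, forall k, (k <= n)%N ->
  \sum_(t < n.+1) w t * t%:R ^+ k = (gmom k)%:R.
Proof.
pose a : 'rV[K]_n.+1 := \row_t t%:R.
pose V := Vandermonde n.+1 a.
have Vu : V^T \in unitmx.
  rewrite unitmx_tr unitmxE det_Vandermonde unitfE; apply/prodf_neq0 => i _.
  apply/prodf_neq0 => j ij; rewrite !mxE subr_eq0 eqr_nat.
  by rewrite eq_sym (ltn_eqF ij).
pose mo : 'rV[K]_n.+1 := \row_k (gmom k)%:R.
exists ((mo *m invmx V^T) 0) => k kn.
have := congr1 (fun A : 'rV[K]_n.+1 => A 0 (Ordinal (kn : (k < n.+1)%N))) (mulmxKV Vu mo).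
rewrite mxE [RHS]mxE /= => <-; apply: eq_bigr => t _.
by congr (_ * _); rewrite !mxE.
Qed.

(** The weights [w] and the nodes [v] compute the Gaussian expectation of all
    polynomials of degree at most [n].  The coefficients may lie in any
    commutative ring receiving a morphism from [K], so that the same formula
    serves for scalars and for functions on so_N. *)
Definition is_cubature M (S : finType) (w : S -> K) (v : S -> 'I_M -> K) : Prop :=
  forall (R : comNzRingType) (f : {rmorphism K -> R}) (h : {mpoly R[M]}),
    (msize h <= n.+1)%N ->
    gauss h = \sum_s f (w s) * h.@[fun i => f (v s i)].

(** Tensor powers of the one-variable formula. *)
Lemma gauss_cubature M :
  exists (S : finType) (w : S -> K) (v : S -> 'I_M -> K), is_cubature w v.
Proof.
have [w wP] := gauss_weights.
exists {ffun 'I_M -> 'I_n.+1}, (fun s : {ffun 'I_M -> 'I_n.+1} => \prod_i w (s i)),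
  (fun (s : {ffun 'I_M -> 'I_n.+1}) i => (s i)%:R).
move=> R f h hn; rewrite /gauss (monom_linwE _ hn).
transitivity (\sum_(s : {ffun 'I_M -> 'I_n.+1})
    \sum_(m : 'X_{1..M < n.+1})
      h@_m * (f (\prod_i w (s i)) * \prod_i f (s i)%:R ^+ m i)); last first.
  apply: eq_bigr => s _; rewrite [h in h.@[_]](mpolywE hn) raddf_sum /= mulr_sumr.
  by apply: eq_bigr => m _; rewrite mevalZ mevalX mulrCA.
rewrite exchange_big /=; apply: eq_bigr => m _; rewrite -mulr_sumr.
congr (_ * _).
transitivity (\sum_(s : {ffun 'I_M -> 'I_n.+1})
    \prod_i f (w (s i) * (s i)%:R ^+ m i)); last first.
  apply: eq_bigr => s _; rewrite rmorph_prod -big_split /=.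
  by apply: eq_bigr => i _; rewrite rmorphM rmorphXn.
rewrite -(bigA_distr_bigA (fun i t => f (w t * t%:R ^+ m i))) natr_prod.
apply: eq_bigr => i _; rewrite -rmorph_sum wP ?rmorph_nat //.
have := bmdeg m; rewrite ltnS; apply: leq_trans.
by rewrite mdegE (bigD1 i) //= leq_addr.
Qed.

End Cubature.

(** * Gaussian moments of a skew bilinear form *)

Lemma mderivU (n : nat) (R : nzRingType) (i j : 'I_n) :
  ('X_i : {mpoly R[n]})^`M(j) = (i == j)%:R.
Proof.
rewrite mderivX mnm1E; case: eqVneq => [->|_]; last by rewrite scale0r.
by rewrite -{1}[U_(j)%MM]add0m addmK mpolyX0 scale1r.
Qed.

Lemma mderiv_expS (n : nat) (R : comNzRingType) (i : 'I_n) (h : {mpoly R[n]}) k :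
  (h ^+ k.+1)^`M(i) = k.+1%:R * (h ^+ k * h^`M(i)).
Proof.
elim: k => [|k IH]; first by rewrite expr0 expr1 !mul1r.
rewrite exprS mderivM IH [in RHS]mulrSr exprS; ring.
Qed.

Section WickRecursion.
Variables (N : nat) (R : comNzRingType) (A : 'M[R]_N).
Hypothesis skA : A^T = - A.

(** The first [N] variables are the coordinates of p, the last [N] those of q. *)
Definition pvar (i : 'I_N) : {mpoly R[N + N]} := 'X_(lshift N i).
Definition qvar (i : 'I_N) : {mpoly R[N + N]} := 'X_(rshift N i).

Lemma pvar_dp i j : (pvar i)^`M(lshift N j) = (i == j)%:R.
Proof. by rewrite mderivU eq_lshift. Qed.
Lemma pvar_dq i j : (pvar i)^`M(rshift N j) = 0.
Proof. by rewrite mderivU eq_lrshift. Qed.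
Lemma qvar_dp i j : (qvar i)^`M(lshift N j) = 0.
Proof. by rewrite mderivU eq_rlshift. Qed.
Lemma qvar_dq i j : (qvar i)^`M(rshift N j) = (i == j)%:R.
Proof. by rewrite mderivU eq_rshift. Qed.

(** The bilinear form [(q, A p)]. *)
Definition biform : {mpoly R[N + N]} :=
  \sum_i \sum_j A i j *: (qvar i * pvar j).

Lemma dbiform_p j : biform^`M(lshift N j) = \sum_i A i j *: qvar i.
Proof.
rewrite /biform raddf_sum; apply: eq_bigr => i _ /=.
rewrite raddf_sum (bigD1 j) //= big1 => [|k kj].
  by rewrite mderivZ mderivM qvar_dp pvar_dp eqxx mul0r add0r mulr1 addr0.
by rewrite mderivZ mderivM qvar_dp pvar_dp (negPf kj) mul0r mulr0 addr0 scaler0.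
Qed.

Lemma dbiform_q i : biform^`M(rshift N i) = \sum_j A i j *: pvar j.
Proof.
rewrite /biform exchange_big raddf_sum; apply: eq_bigr => j _ /=.
rewrite raddf_sum (bigD1 i) //= big1 => [|k ki].
  by rewrite mderivZ mderivM qvar_dq pvar_dq eqxx mulr0 mul1r !addr0.
by rewrite mderivZ mderivM qvar_dq pvar_dq (negPf ki) mulr0 mul0r addr0 scaler0.
Qed.

(** [E (q, A p)^n], [E p p^T (q, A p)^n] and [E p q^T (q, A p)^n]. *)
Definition wick0 n : R := gauss (biform ^+ n).
Definition wickpp n : 'M[R]_N := \matrix_(i, j) gauss (pvar i * pvar j * biform ^+ n).
Definition wickpq n : 'M[R]_N := \matrix_(i, j) gauss (pvar i * qvar j * biform ^+ n).

Lemma wickppT n : (wickpp n)^T = wickpp n.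
Proof. by apply/matrixP => i j; rewrite !mxE (mulrC (pvar j)). Qed.

Lemma wick00 : wick0 0 = 1.
Proof. by rewrite /wick0 expr0 gauss1. Qed.

Lemma wickpp0 : wickpp 0 = 1%:M.
Proof.
apply/matrixP => i j; rewrite !mxE expr0 mulr1 gauss_byparts pvar_dp eq_sym.
by case: eqP => _; [exact: gauss1|exact: raddf0].
Qed.

Lemma wickpqS n : wickpq n.+1 = n.+1%:R *: (wickpp n *m A^T).
Proof.
apply/matrixP => i j; rewrite !mxE (mulrC (pvar i)) -mulrA gauss_byparts.
rewrite mderivM pvar_dq mul0r add0r mderiv_expS dbiform_q.
rewrite mulrCA !mulr_sumr gauss_sum; apply: eq_bigr => k _.
rewrite !mxE; set h := (X in gauss X).
have -> : h = (n.+1%:R * A j k) *: (pvar i * pvar k * biform ^+ n).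
  by rewrite /h -!mul_mpolyC mpolyCM rmorph_nat; ring.
by rewrite gaussZ; ring.
Qed.

Lemma wickppS n :
  wickpp n.+1 = (wick0 n.+1)%:M + n.+1%:R *: (A^T *m (wickpq n)^T).
Proof.
apply/matrixP => i j; rewrite !mxE -mulrA gauss_byparts mderivM pvar_dp gaussD.
congr (_ + _).
  by rewrite eq_sym; case: eqP => _; rewrite ?mul1r // mul0r raddf0.
rewrite mderiv_expS dbiform_p mulrCA !mulr_sumr gauss_sum.
apply: eq_bigr => k _; rewrite !mxE; set h := (X in gauss X).
have -> : h = (n.+1%:R * A k i) *: (pvar j * qvar k * biform ^+ n).
  by rewrite /h -!mul_mpolyC mpolyCM rmorph_nat; ring.
by rewrite gaussZ; ring.
Qed.

Lemma wick0S n : wick0 n.+1 = \tr (A *m wickpq n).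
Proof.
rewrite /wick0 exprS /biform mulr_suml gauss_sum; apply: eq_bigr => i _.
rewrite mulr_suml gauss_sum mxE; apply: eq_bigr => j _.
by rewrite mxE -scalerAl gaussZ (mulrC (qvar i)).
Qed.

Lemma wickppSS n : wickpp n.+2 =
  (wick0 n.+2)%:M - (n.+2 * n.+1)%:R *: (A *m A *m wickpp n).
Proof.
rewrite wickppS wickpqS linearZ /= trmx_mul trmxK wickppT -scalemxAr scalerA.
by rewrite -natrM skA mulNmx mulmxA scalerN.
Qed.

Lemma wick0SS n : wick0 n.+2 = - n.+1%:R * \tr (A *m A *m wickpp n).
Proof.
rewrite wick0S wickpqS -scalemxAr linearZ /= skA !mulmxN linearN /= mulrN mulNr.
by rewrite mulmxA mxtrace_mulC mulmxA.
Qed.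

Variable c : nat -> R.
Hypothesis cP : forall j, wick0 (2 * j) = (2 * j)`!%:R * c j.

(** Coefficientwise form of
    [E p p^T exp(tau (q, A p)) = (1 + tau^2 A^2)^(-1) E exp(tau (q, A p))]. *)
Lemma wickpp_even j : wickpp (2 * j) =
  (2 * j)`!%:R *: \sum_(k < j.+1) ((-1) ^+ k * c (j - k)) *: A ^+ (2 * k).
Proof.
elim: j => [|j IH].
  rewrite big_ord1 wickpp0 expr0 mul1r fact0 scale1r subn0.
  by have := cP 0; rewrite muln0 wick00 fact0 mul1r => <-; rewrite scale1r.
have e : (2 * j.+1 = (2 * j).+2)%N by lia.
rewrite {1}e wickppSS IH -e cP [in RHS]big_ord_recl mul1r subn0 scalerDr.
rewrite [A ^+ (2 * ord0)]expr0 scalerA scalemx1; congr (_ + _).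
rewrite -scalemxAr scalerA -scaleNr mulmx_sumr !scaler_sumr.
apply: eq_bigr => k _; rewrite -scalemxAr !scalerA.
have -> : A ^+ (2 * lift ord0 k) = A *m A *m A ^+ (2 * k).
  by rewrite lift0 mulnS exprD expr2.
congr (_ *: _); rewrite lift0 exprS subSS e !factS !natrM; ring.
Qed.

(** This recursion determines the [c j] from [c 0 = 1]; the determinant series
    satisfies it too. *)
Lemma wick_trace_recursion j : (2 * j.+1)`!%:R * c j.+1 =
  - (2 * j).+1`!%:R *
    \sum_(k < j.+1) (-1) ^+ k * \tr (A ^+ (2 * k.+1)) * c (j - k).
Proof.
have e : (2 * j.+1 = (2 * j).+2)%N by lia.
rewrite -cP {1}e wick0SS wickpp_even -scalemxAr mulmx_sumr mxtraceZ.
rewrite raddf_sum mulrA -natr1 factS !mulr_sumr; apply: eq_bigr => k _.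
rewrite -scalemxAr /= mxtraceZ.
have -> : A ^+ (2 * k.+1) = A *m A *m A ^+ (2 * k).
  by rewrite mulnS exprD expr2.
by rewrite natrM; ring.
Qed.

Lemma wickpq_odd j : wickpq (2 * j).+1 =
  - (2 * j).+1`!%:R *:
     \sum_(k < j.+1) ((-1) ^+ k * c (j - k)) *: A ^+ (2 * k + 1).
Proof.
rewrite wickpqS skA mulmxN wickpp_even -scalemxAl scalerN scalerA.
rewrite factS natrM scaleNr; congr (- (_ *: _)).
rewrite mulmx_suml; apply: eq_bigr => k _.
by rewrite -scalemxAl exprD expr1.
Qed.
End WickRecursion.

(** * Logarithmic derivative of a determinant *)

Section DetDerivative.
Variable (R : comNzRingType).

Lemma deriv_prod (I : finType) (F : I -> {poly R}) :
  (\prod_i F i)^`() = \sum_i (F i)^`() * \prod_(j | j != i) F j.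
Proof.
suff H (s : seq I) : uniq s -> (\prod_(i <- s) F i)^`() =
    \sum_(i <- s) (F i)^`() * \prod_(j <- s | j != i) F j.
  rewrite (H (index_enum I)) ?index_enum_uniq //.
elim: s => [|a s IH] /=; first by rewrite !big_nil derivC.
case/andP=> as_ us; rewrite !big_cons derivM eqxx /= IH //; congr (_ * _ + _).
  by rewrite big_seq_cond [RHS]big_seq_cond; apply: eq_bigl => i;
    case: eqVneq => [->|]; rewrite ?andbT // (negPf as_).
rewrite mulr_sumr big_seq [RHS]big_seq; apply: eq_bigr => i is_.
rewrite big_cons; case: eqVneq => [ai|_]; last by rewrite mulrCA.
by rewrite ai is_ in as_.
Qed.

(** Jacobi's formula. *)
Lemma deriv_det n (M : 'M[{poly R}]_n) :
  (\det M)^`() = \tr (\adj M *m map_mx (@deriv R) M).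
Proof.
transitivity (\sum_i \sum_j (M i j)^`() * cofactor M i j); last first.
  rewrite /mxtrace exchange_big; apply: eq_bigr => j _; rewrite mxE.
  by apply: eq_bigr => i _; rewrite !mxE mulrC.
transitivity (\sum_i \det (\matrix_(k, l) if k == i then (M k l)^`() else M k l)).
  rewrite /determinant raddf_sum exchange_big; apply: eq_bigr => s _ /=.
  rewrite -signr_odd -polyC1 -polyCN -!polyC_exp derivM derivC mul0r add0r.
  rewrite deriv_prod mulr_sumr; apply: eq_bigr => i _; congr (_ * _).
  rewrite [RHS](bigD1 i) //= mxE eqxx; congr (_ * _).
  by apply: eq_bigr => k ki; rewrite mxE (negPf ki).
apply: eq_bigr => i _; rewrite (expand_det_row _ i); apply: eq_bigr => j _.
rewrite mxE eqxx; congr (_ * _); rewrite /cofactor; congr (_ * \det _).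
apply/matrixP => k l; rewrite !mxE.
by rewrite eq_sym (negPf (neq_lift _ _)).
Qed.

Variables (N : nat) (B : 'M[R]_N).
Let D : {poly R} := \det (1%:M + 'X *: map_mx polyC B).

(** [D' = D tr(B (1 + X B)^(-1))] modulo [X^n], for [D = det (1 + X B)]. *)
Lemma det_logderiv n : exists c : {poly R},
  D^`() = D * \poly_(k < n) ((-1) ^+ k * \tr (B ^+ k.+1)) + c * 'X^n.
Proof.
pose P : 'M[{poly R}]_N := map_mx polyC B.
pose M : 'M[{poly R}]_N := 1%:M + 'X *: P.
have dM : map_mx (@deriv R) M = P.
  apply/matrixP => i j; rewrite !mxE derivD derivM derivX mul1r derivC mulr0.
  by rewrite addr0 derivMn derivC mul0rn add0r.
pose Y k : 'M[{poly R}]_N := \sum_(i < k) (- 'X) ^+ i *: P ^+ i.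
have PP k : P ^+ k *m P = P ^+ k.+1 by rewrite exprSr.
have PB k : P ^+ k = map_mx polyC (B ^+ k).
  elim: k => [|k IH]; first by rewrite !expr0 map_scalar_mx.
  by rewrite -PP exprSr map_mxM IH.
have MY k : M *m Y k = 1%:M - (- 'X) ^+ k *: P ^+ k.
  elim: k => [|k IH]; first by rewrite /Y big_ord0 mulmx0 !expr0 scale1r subrr.
  rewrite /Y big_ord_recr -/(Y k) mulmxDr IH -addrA; congr (_ + _).
  rewrite mulmxDl mul1mx -scalemxAr -scalemxAl addKr scalerA exprS.
  by rewrite mulNr scaleNr opprK mulrC /= -[P *m _]/(P * _) -exprS.
exists ((-1) ^+ n * \tr (\adj M *m P ^+ n.+1)).
rewrite /D deriv_det dM -/P -/M.
have DY : \det M *: Y n = \adj M - (- 'X) ^+ n *: (\adj M *m P ^+ n).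
  have := congr1 (mulmx (\adj M)) (MY n).
  rewrite mulmxA mul_adj_mx mul_scalar_mx => ->.
  by rewrite mulmxBr mulmx1 -scalemxAr.
have := congr1 (fun Z => \tr (Z *m P)) DY => /=.
rewrite mulmxBl linearB /= -!scalemxAl !mxtraceZ -mulmxA.
rewrite PP => /eqP.
rewrite eq_sym subr_eq => /eqP ->; congr (_ * _ + _).
  rewrite mulmx_suml raddf_sum poly_def; apply: eq_bigr => k _ /=.
  rewrite -scalemxAl mxtraceZ PP PB trace_map_mx -mul_polyC polyCM rmorphXn.
  by rewrite rmorphN1 [(- 'X) ^+ k]exprNn mulrAC.
by rewrite [in LHS]exprNn mulrAC.
Qed.

(** The coefficients of [q = D^(-1/2)] satisfy [2 q' = - q D'/D]. *)
Lemma invsqrt_recursion (q : {poly R}) n :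
  (forall k, (k <= n)%N -> (q ^+ 2 * D)`_k = (k == 0%N)%:R) ->
  forall j, (j < n)%N -> (2 * j.+1)%:R * q`_j.+1 =
    - \sum_(k < j.+1) (-1) ^+ k * \tr (B ^+ k.+1) * q`_(j - k).
Proof.
move=> qP j jn; have [c cP] := det_logderiv n.
pose e := \poly_(i < size (q ^+ 2 * D)) (q ^+ 2 * D)`_(i + n.+1).
have De : q ^+ 2 * D = 1 + e * 'X^(n.+1).
  apply/polyP => k; rewrite coefD coef1 coefMXn ltnS coef_poly.
  case: (leqP k n) => [kn|nk]; first by rewrite addr0 qP.
  have -> : (k == 0%N) = false by apply/eqP => k0; rewrite k0 in nk.
  rewrite add0r subnK //; case: ltnP => // kn'.
  by rewrite nth_default //; apply: leq_trans kn' (leq_subr _ _).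
set T := \poly_(_ < _) _ in cP.
(* From q^2 D = 1 modulo X^(n+1): differentiate, replace D' by D T, and cancel
   D with one more factor q. *)
have key : exists d, 2%:R * q^`() + q * T = d * 'X^n.
  have := congr1 (@deriv R) De.
  rewrite expr2 -polyC1 derivD derivC add0r !derivM derivXn cP [_.+1.-1]/= exprS => H.
  exists (q * (e^`() * 'X + e *+ n.+1 - q ^+ 2 * c) - e * 'X * (2%:R * q^`() + q * T)).
  have {}H : q * (q * (2%:R * q^`() + q * T) * D) =
     q * ((e^`() * 'X + e *+ n.+1 - q ^+ 2 * c) * 'X^n).
    congr (q * _); move: H; rewrite -mulr_natr => H.
    apply: (@addIr _ (q ^+ 2 * c * 'X^n)).
    transitivity ((q^`() * q + q * q^`()) * D +
      q * q * (D * T + c * 'X^n)); first by ring.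
    by rewrite H; ring.
  have : (q ^+ 2 * D) * (2%:R * q^`() + q * T) =
     q * ((e^`() * 'X + e *+ n.+1 - q ^+ 2 * c) * 'X^n).
    by rewrite -H; ring.
  rewrite De exprS => H2.
  apply: (@addIr _ (e * ('X * 'X^n) * (2%:R * q^`() + q * T))).
  transitivity ((1 + e * ('X * 'X^n)) * (2%:R * q^`() + q * T)); first by ring.
  by rewrite H2; ring.
have [d dP] := key.
have := congr1 (fun p : {poly R} => p`_j) dP; rewrite coefMXn jn coefD.
rewrite mulr_natl coefMn coef_deriv coefM => /eqP; rewrite addr_eq0 => /eqP H.
have -> : (2 * j.+1)%:R * q`_j.+1 = q`_j.+1 *+ j.+1 *+ 2.
  by rewrite -mulrnA mulnC mulr_natl.
rewrite H; congr (- _); rewrite (reindex_inj rev_ord_inj) /=.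
apply: eq_bigr => k _; rewrite subSS subKn; last by rewrite -ltnS.
by rewrite coef_poly (leq_trans (ltn_ord k) jn) mulrC.
Qed.

End DetDerivative.

(** * The determinant series as a series of Gaussian moments *)

Section SoCoefficients.
Variables (F : numFieldType) (N : nat).
Local Notation so := (so F N).
Local Notation Sso := (Sso F N).
Local Notation so_generic := (so_generic F N).
Local Notation so_basis := (@so_basis F N).
Implicit Types (p q x y : 'cV[F]_N) (B : so).

Lemma so_generic_skew : so_generic^T = - so_generic.
Proof.
apply/matrixP => i j; rewrite !mxE !summxE -sumrN; apply: eq_bigr => k _.
have /matrixP/(_ i j) := soP (so_basis k).
by rewrite ![map_mx _ _ _ _]mxE !mxE => ->; rewrite mpolyCN mulrN.
Qed.

(** Odd powers of a skew matrix are skew. *)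
Lemma skew_quad (R : comNzRingType) (A : 'M[R]_N) (u v : 'cV[R]_N) k :
  A^T = - A -> (u^T *m A ^+ (2 * k + 1) *m v) 0 0 =
  - (v^T *m A ^+ (2 * k + 1) *m u) 0 0.
Proof.
move=> skA; have skP n : (A ^+ n)^T = (-1) ^+ n *: A ^+ n.
  elim: n => [|n IH]; first by rewrite !expr0 scale1r trmx1.
  rewrite {1}exprSr -[_ * A]/(_ *m A) trmx_mul IH skA -scalemxAr mulNmx -scaleN1r.
  by rewrite scalerA -exprSr -[A *m _]/(A * _) -exprS.
transitivity ((u^T *m A ^+ (2 * k + 1) *m v)^T 0 0); first by rewrite [RHS]mxE.
rewrite !trmx_mul trmxK skP exprD exprM sqrrN !expr1n mul1r scaleN1r.
by rewrite mulNmx mulmxN mxE mulmxA.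
Qed.

Lemma det_coef0 : det_coef F N 0 = 1.
Proof. by rewrite /det_coef /invsqrt_coef /= coef1. Qed.

Lemma det_coef_recursion j : (2 * j.+1)%:R * det_coef F N j.+1 =
  - \sum_(k < j.+1) (-1) ^+ k * \tr (so_generic ^+ (2 * k.+1)) * det_coef F N (j - k).
Proof.
pose q := invsqrt_trunc (det1A2 F N) j.+1.
have qE k : (k <= j.+1)%N -> q`_k = det_coef F N k.
  by move=> kj; rewrite /q invsqrt_truncE coef_poly ltnS kj.
have := @invsqrt_recursion _ N (so_generic *m so_generic) q j.+1.
move=> /(_ (fun k kj => invsqrt_trunc_correct (det1A2_0 F N) kj) j (ltnSn j)).
rewrite qE // => ->; congr (- _); apply: eq_bigr => k _.
by rewrite qE ?(leq_trans (leq_subr _ _)) // exprM expr2.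
Qed.

Lemma Sso_natr_eq0 n : (n%:R == 0 :> Sso) = (n == 0%N).
Proof. by rewrite -mpolyC_nat mpolyC_eq0 pnatr_eq0. Qed.

(** [det (1 + tau^2 A^2)^(-1/2)] is the exponential generating series of the
    moments [E (q, A p)^(2j)]. *)
Lemma det_coef_wick j :
  wick0 so_generic (2 * j) = (2 * j)`!%:R * det_coef F N j.
Proof.
have fact_neq0 n : n`!%:R != 0 :> F by rewrite pnatr_eq0 -lt0n fact_gt0.
pose c j := ((2 * j)`!%:R^-1 : F) *: wick0 so_generic (2 * j).
have cP i : wick0 so_generic (2 * i) = (2 * i)`!%:R * c i.
  rewrite /c -scalerAr mulr_natl -scaler_nat scalerA mulVf ?scale1r //.
rewrite cP; congr (_ * _); elim/ltn_ind: j => -[|j] IH.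
  by rewrite det_coef0 /c muln0 wick00 invr1 scale1r.
have Sneq0 n : n.+1%:R != 0 :> Sso by rewrite Sso_natr_eq0.
apply: (mulfI (Sneq0 (2 * j).+1)); rewrite -[(2 * j).+2]/(1 + 1 + 2 * j)%N.
have e : (2 * j.+1 = (2 * j).+2)%N by lia.
rewrite [(1 + 1 + 2 * j)%N](_ : _ = 2 * j.+1)%N ?det_coef_recursion; last by lia.
have fneq0 : (2 * j).+1`!%:R != 0 :> Sso by rewrite Sso_natr_eq0 -lt0n fact_gt0.
apply: (mulfI fneq0); have := wick_trace_recursion so_generic_skew cP j.
rewrite {1}e factS -e natrM => H.
rewrite mulrA (mulrC _ (2 * j.+1)%:R) H mulNr mulrN; congr (- (_ * _)).
apply: eq_bigr => k _; congr (_ * _); apply: IH.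
by rewrite ltnS leq_subr.
Qed.

Lemma so_gamma_wick j x y : (2 * j).+1`!%:R * so_gamma j x y =
  - ((map_mx (@mpolyC (so_dim N) F) x)^T *m wickpq so_generic (2 * j).+1
       *m map_mx (@mpolyC (so_dim N) F) y) 0 0.
Proof.
rewrite (wickpq_odd so_generic_skew det_coef_wick) -scalemxAr -scalemxAl.
rewrite mxE mulNr opprK; congr (_ * _).
rewrite mulmx_sumr mulmx_suml summxE; apply: eq_bigr => k _.
by rewrite -scalemxAr -scalemxAl [RHS]mxE mulrAC.
Qed.

Lemma so_gamma_anti j x y : so_gamma j x y = - so_gamma j y x.
Proof.
rewrite /so_gamma -sumrN; apply: eq_bigr => k _.
by rewrite skew_quad ?so_generic_skew // mulrN mulNr.
Qed.

End SoCoefficients.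

(** * Averages of powers of rank-two elements *)

Lemma pvar_homog (N : nat) (R : comNzRingType) (i : 'I_N) : pvar R i \is 1.-homog.
Proof. by rewrite dhomogX /= mdeg1. Qed.
Lemma qvar_homog (N : nat) (R : comNzRingType) (i : 'I_N) : qvar R i \is 1.-homog.
Proof. by rewrite dhomogX /= mdeg1. Qed.

Lemma biform_homog (N : nat) (R : comNzRingType) (A : 'M[R]_N) :
  biform A \is 2.-homog.
Proof.
apply: rpred_sum => i _; apply: rpred_sum => j _; apply: rpredZ.
exact: dhomogM (qvar_homog _ i) (pvar_homog _ j).
Qed.

Lemma dhomog_msize_le (n d : nat) (R : nzRingType) (h : {mpoly R[n]}) :
  h \is d.-homog -> (msize h <= d.+1)%N.
Proof.
move=> /dhomogP hd; rewrite msizeE big_seq; elim/big_ind: _ => //.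
  by move=> a b; rewrite geq_max => -> ->.
by move=> m /hd /= ->.
Qed.

Lemma bilinE (R : comNzRingType) (N : nat) (A : 'M[R]_N) (u v : 'cV[R]_N) :
  (u^T *m A *m v) 0 0 = \sum_i \sum_j u i 0 * A i j * v j 0.
Proof.
rewrite mxE exchange_big; apply: eq_bigr => j _ /=; rewrite !mxE mulr_suml.
by apply: eq_bigr => i _; rewrite !mxE.
Qed.

Section SoLin.
Variables (F : numFieldType) (N : nat).
Local Notation so := (so F N).
Local Notation Sso := (Sso F N).
Local Notation so_generic := (so_generic F N).
Local Notation so_basis := (@so_basis F N).
Implicit Types (p q x y : 'cV[F]_N) (B : so).

(** The coordinates of an element of so_N in the basis [so_basis]; the factor
    -1/2 is due to [tr(L_ij L_ij) = -2]. *)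
Definition so_coef B (k : 'I_(so_dim N)) : F := - 2^-1 * \tr (B *m so_basis k).

(** The linear function [A |-> tr(A B)] as an element of C[so_N]. *)
Definition so_lin B : Sso := \sum_k so_coef B k *: 'X_k.

Lemma so_coefE B : B = \sum_k so_coef B k *: so_basis k.
Proof.
apply: val_inj; rewrite raddf_sum; apply/matrixP => i j /=.
rewrite summxE -so_genericE /so_generic summxE /Sso_eval raddf_sum.
apply: eq_bigr => k _ /=; rewrite !mxE [X in X.@[_]]/= .
by rewrite mevalM mevalZ mevalXU mevalC.
Qed.

Fact wedge_subproof p q : 2^-1 *: (p *m q^T - q *m p^T) \in @skew_pred F N.
Proof.
rewrite rpredZ // unfold_in linearB /= !trmx_mul !trmxK opprB //.
Qed.

(** The rank-two element [(p q^T - q p^T)/2], whose linear function is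
    [A |-> (q, A p)]. *)
Definition wedge p q : so := So (wedge_subproof p q).

Lemma mxtrace_wedge p q B : \tr (wedge p q *m B) = (q^T *m B *m p) 0 0.
Proof.
rewrite /= -scalemxAl mxtraceZ mulmxBl linearB /=.
have t (a b : 'cV[F]_N) : \tr (a *m b^T *m B) = (b^T *m B *m a) 0 0.
  by rewrite -mulmxA mxtrace_mulC trace_mx11.
rewrite !t.
have := skew_quad p q 0 (soP B); rewrite muln0 add0n expr1 => ->.
by rewrite opprK -mulr2n -[X in _ * X]mulr_natl mulKf // pnatr_eq0.
Qed.

Lemma so_coef_wedge p q k :
  so_coef (wedge p q) k = - 2^-1 * (q^T *m so_basis k *m p) 0 0.
Proof. by rewrite /so_coef mxtrace_wedge. Qed.

(** The two vectors p and q encoded by a point of [F^(2N)]. *)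
Definition pvec (v : 'I_(N + N) -> F) : 'cV[F]_N := \col_i v (lshift N i).
Definition qvec (v : 'I_(N + N) -> F) : 'cV[F]_N := \col_i v (rshift N i).

Lemma biform_eval (v : 'I_(N + N) -> F) :
  (biform so_generic).@[fun i => (v i)%:MP] = so_lin (wedge (pvec v) (qvec v)).
Proof.
transitivity (\sum_i \sum_j so_generic i j * (v (rshift N i) * v (lshift N j))%:MP).
  rewrite /biform raddf_sum; apply: eq_bigr => i _ /=; rewrite raddf_sum.
  by apply: eq_bigr => j _ /=; rewrite mevalZ mevalM !mevalXU mpolyCM.
transitivity (\sum_i \sum_j \sum_k
   - 2^-1 *: 'X_k * (so_basis k i j)%:MP * (v (rshift N i) * v (lshift N j))%:MP : Sso).
  apply: eq_bigr => i _; apply: eq_bigr => j _; rewrite -mulr_suml; congr (_ * _).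
  by rewrite summxE; apply: eq_bigr => k _; rewrite !mxE.
under eq_bigr => i _ do rewrite exchange_big.
rewrite exchange_big; apply: eq_bigr => k _ /=; rewrite so_coef_wedge.
rewrite bilinE mulr_sumr scaler_suml; apply: eq_bigr => i _.
rewrite mulr_sumr scaler_suml; apply: eq_bigr => j _.
rewrite -mulrA -mpolyCM mulrC mul_mpolyC scalerA !mxE; congr (_ *: _); ring.
Qed.


Section Transfer.
Variables (n : nat) (S : finType) (w : S -> F) (v : S -> 'I_(N + N) -> F).
Hypothesis cub : is_cubature n w v.
Let B s := wedge (pvec (v s)) (qvec (v s)).

Lemma det_coef_cubature j : (4 * j <= n)%N ->
  det_coef F N j = \sum_s (w s / (2 * j)`!%:R) *: so_lin (B s) ^+ (2 * j).
Proof.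
move=> jn; apply: (@mulfI _ (2 * j)`!%:R).
  by rewrite Sso_natr_eq0 -lt0n fact_gt0.
rewrite -det_coef_wick /wick0 (cub (@mpolyC (so_dim N) F)); last first.
  apply: leq_trans (dhomog_msize_le (dhomogMn _ (biform_homog _))) _.
  by rewrite ltnS; lia.
rewrite mulr_sumr; apply: eq_bigr => s _.
rewrite rmorphXn /= biform_eval mul_mpolyC -scalerAr mulr_natl -scaler_nat scalerA.
by rewrite divfK // pnatr_eq0 -lt0n fact_gt0.
Qed.

(** Averaging with the antisymmetry of [so_gamma] in [x] and [y] replaces
    [(x, p) (q, y)] by [(x, B y)]. *)
Lemma so_gamma_cubature j x y : (4 * j + 4 <= n)%N ->
  so_gamma j x y =
    - \sum_s (w s / (2 * j).+1`!%:R * (x^T *m B s *m y) 0 0) *: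
        so_lin (B s) ^+ (2 * j).+1.
Proof.
move=> jn; have f0 : (2 * j).+1`!%:R != 0 :> F by rewrite pnatr_eq0 -lt0n fact_gt0.
pose G x y : Sso := \sum_s (w s / (2 * j).+1`!%:R *
   ((x^T *m pvec (v s)) 0 0 * (y^T *m qvec (v s)) 0 0)) *: so_lin (B s) ^+ (2 * j).+1.
have GE a b : so_gamma j a b = - G a b.
  apply: (@mulfI _ (2 * j).+1`!%:R).
    by rewrite Sso_natr_eq0 -lt0n fact_gt0.
  rewrite so_gamma_wick mulrN; congr (- _); rewrite bilinE.
  transitivity (\sum_k \sum_l \sum_s (w s * (a k 0 * pvec (v s) k 0 *
     (b l 0 * qvec (v s) l 0))) *: so_lin (B s) ^+ (2 * j).+1 : Sso).
    apply: eq_bigr => k _; apply: eq_bigr => l _; rewrite !mxE.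
    rewrite (cub (@mpolyC (so_dim N) F)); last first.
      apply: leq_trans (dhomog_msize_le (dhomogM (dhomogM (pvar_homog _ _)
         (qvar_homog _ _)) (dhomogMn _ (biform_homog _)))) _.
      by rewrite ltnS; lia.
    rewrite mulr_sumr mulr_suml; apply: eq_bigr => s _.
    rewrite !rmorphM rmorphXn /= biform_eval !mevalXU -mul_mpolyC !mpolyCM !mxE.
    ring.
  under eq_bigr => k _ do rewrite exchange_big.
  rewrite exchange_big mulr_sumr; apply: eq_bigr => s _ /=.
  rewrite -scalerAr mulr_natl -scaler_nat scalerA.
  set X := (Y in Y *: _); set T := so_lin _ ^+ _.
  have -> : X = w s * ((a^T *m pvec (v s)) 0 0 * (b^T *m qvec (v s)) 0 0).
    by rewrite /X; field.
  rewrite !mxE big_distrlr /= mulr_sumr scaler_suml.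
  apply: eq_bigr => k _; rewrite mulr_sumr scaler_suml.
  by apply: eq_bigr => l _; rewrite !mxE.
have -> : so_gamma j x y = 2^-1 *: (so_gamma j x y - so_gamma j y x).
  rewrite [in X in _ - X]so_gamma_anti opprK -mulr2n -scaler_nat scalerA.
  by rewrite mulVf ?scale1r // pnatr_eq0.
rewrite !GE opprK addrC -opprB scalerN; congr (- _).
rewrite /G -sumrB scaler_sumr; apply: eq_bigr => s _.
rewrite -scalerBl scalerA; congr (_ *: _).
have -> : (x^T *m B s *m y) 0 0 = 2^-1 *
   ((x^T *m pvec (v s)) 0 0 * (y^T *m qvec (v s)) 0 0 -
    (y^T *m pvec (v s)) 0 0 * (x^T *m qvec (v s)) 0 0).
  rewrite /= -scalemxAr -scalemxAl mxE; congr (_ * _).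
  rewrite mulmxBr mulmxBl.
  have t (a b c d : 'cV[F]_N) : (a^T *m (b *m c^T) *m d) 0 0 =
     (a^T *m b) 0 0 * (d^T *m c) 0 0.
    rewrite mulmxA -mulmxA [LHS]mxE big_ord1; congr (_ * _).
    by rewrite !mxE; apply: eq_bigr => i _; rewrite !mxE mulrC.
  by rewrite [LHS]mxE [X in _ + X]mxE !t; congr (_ - _); rewrite mulrC.
by ring.
Qed.
End Transfer.
End SoLin.

(** * Presented algebras and symmetrization *)

Lemma commutator_Mr (T : pzRingType) (a b c : T) :
  (a * b - b * a) * c + b * (a * c - c * a) = a * (b * c) - b * c * a.
Proof. by rewrite mulrBl mulrBr !mulrA addrA subrK. Qed.

Lemma commutator_Ml (T : pzRingType) (a b c : T) :
  a * (a * c - c * a) + (a * c - c * a) * a = a * (a * c + c * a) - (a * c + c * a) * a.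
Proof.
by rewrite mulrBr mulrBl mulrDr mulrDl !mulrA addrA subrK opprD addrA addrK.
Qed.

Lemma commutator_sqr (T : pzRingType) (a b : T) :
  a ^+ 2 * b - b * a ^+ 2 = a * (a * b - b * a) + (a * b - b * a) * a.
Proof. by rewrite expr2 mulrBr mulrBl !mulrA addrA subrK. Qed.

Section PresAlg.
Variables (F : fieldType) (X : choiceType) (rel : freeAlg F X -> Prop).
Local Notation T := (presAlg rel).

Lemma presAlg_relE p q : rel (p - q) -> presAlg_pi rel p = presAlg_pi rel q.
Proof. by move=> r; apply/presAlg_eq/tsideal_rel. Qed.

Lemma presAlg_rel_lin c p q r : rel (r - (c *: p + q)) ->
  presAlg_pi rel r = c *: presAlg_pi rel p + presAlg_pi rel q.
Proof. by move=> /presAlg_relE ->; rewrite linearP. Qed.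

Lemma presAlg_rel_mul p q r : rel (r - p * q) ->
  presAlg_pi rel r = presAlg_pi rel p * presAlg_pi rel q.
Proof. by move=> /presAlg_relE ->; rewrite rmorphM. Qed.

(** A defining relation that is a commutator, read in the quotient.  The terms
    are given explicitly because unification may unfold the quotient. *)
Lemma presAlg_rel_comm p q r : rel (p * q - q * p - r) ->
  presAlg_pi rel p * presAlg_pi rel q - presAlg_pi rel q * presAlg_pi rel p =
  presAlg_pi rel r.
Proof.
move=> /presAlg_relE <-.
exact: etrans (congr2 +%R (esym (rmorphM _ p q))
  (congr1 -%R (esym (rmorphM _ q p)))) (esym (raddfB _ _ _)).
Qed.

Lemma presAlg_scaler_prod n (c : 'I_n -> F) (u : 'I_n -> T) :
  \prod_i (c i *: u i) = (\prod_i c i) *: \prod_i u i.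
Proof.
elim: n c u => [|n IH] c u; first by rewrite !big_ord0 scale1r.
by rewrite !big_ord_recl IH -presAlg_scalerAl -presAlg_scalerAr scalerA.
Qed.

Lemma presAlg_sum_expn (I : finType) (c : I -> F) (u : I -> T) n :
  (\sum_k c k *: u k) ^+ n =
  \sum_(t : {ffun 'I_n -> I}) (\prod_i c (t i)) *: \prod_i u (t i).
Proof.
rewrite -[n in LHS]card_ord -prodr_const bigA_distr_bigA.
by apply: eq_bigr => t _; rewrite presAlg_scaler_prod.
Qed.

End PresAlg.

Section Symmetrization.
Variables (F : numFieldType) (N : nat).
Local Notation so := (so F N).
Local Notation Sso := (Sso F N).
Local Notation Uso := (Uso F N).
Local Notation so_basis := (@so_basis F N).

Lemma so_to_U_linear (c : F) (A B : so) :
  so_to_U (c *: A + B) = c *: so_to_U A + so_to_U B.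
Proof. exact: presAlg_rel_lin (U_rel_lin c A B). Qed.

HB.instance Definition _ := GRing.isLinear.Build F so Uso *:%R
  (@so_to_U F N) so_to_U_linear.

Lemma so_to_U_bracket (A B : so) :
  so_to_U A * so_to_U B - so_to_U B * so_to_U A = so_to_U (so_bracket A B).
Proof. exact: presAlg_rel_comm (U_rel_bracket A B). Qed.

(** Makes the length of the sequence a parameter. *)
Lemma symm_prod_sizeE n (s : seq so) : size s = n ->
  symm_prod s = n`!%:R^-1 *: \sum_(sigma : 'S_n) \prod_(k < n) so_to_U s`_(sigma k).
Proof. by move=> <-. Qed.

Lemma symm_prod_perm (s t : seq so) : perm_eq s t -> symm_prod s = symm_prod t.
Proof.
move=> st; pose n := size t; have sn : size s = n by apply: perm_size.
rewrite (symm_prod_sizeE sn) (symm_prod_sizeE (erefl n)); congr (_ *: _).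
have /tuple_permP[p pE] : perm_eq (Tuple (introT eqP sn)) (in_tuple t) by [].
rewrite [RHS](reindex_inj (mulIg p)%g) /=; apply: eq_bigr => sigma _.
apply: eq_bigr => k _; congr so_to_U; rewrite permM.
pose u := [tuple tnth (in_tuple t) (p i) | i < n].
have -> : s = val u by exact: pE.
by rewrite -(tnth_nth 0 u) tnth_mktuple (tnth_nth 0).
Qed.

Lemma symmetrizationE (f : Sso) :
  symmetrization f = monom_lin (fun m => symm_prod (map so_basis (m2s m))) f.
Proof. by []. Qed.

Lemma symmetrization_is_linear : linear (@symmetrization F N).
Proof. by move=> c f g; rewrite !symmetrizationE linearP. Qed.

HB.instance Definition _ := GRing.isLinear.Build F Sso Uso *:%R
  (@symmetrization F N) symmetrization_is_linear.

Lemma symmetrizationZ (c : F) (f : Sso) :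
  symmetrization (c *: f) = c *: symmetrization f.
Proof. exact: linearZ_LR. Qed.

Lemma symmetrization_prodX n (t : 'I_n -> 'I_(so_dim N)) :
  symmetrization (\prod_i 'X_(t i) : Sso) =
  n`!%:R^-1 *: \sum_(sigma : 'S_n) \prod_(k < n) so_to_U (so_basis (t (sigma k))).
Proof.
pose m : 'X_{1..so_dim N} := (\sum_i U_(t i))%MM.
have -> : \prod_i 'X_(t i) = 'X_[m] :> Sso.
  by rewrite /m; elim/big_rec2: _ => [|i p q _ ->]; rewrite ?mpolyX0 ?mpolyXD.
rewrite symmetrizationE monom_linX.
have pm : perm_eq (m2s m) [seq t i | i <- enum 'I_n].
  apply/allP => i _ /=; apply/eqP.
  have := congr1 (fun m' : 'X_{1..so_dim N} => m' i) (s2mK m).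
  rewrite mnmE => ->; rewrite /m mnm_sumE count_map -sum1_count big_enum_cond /=.
  rewrite [RHS]big_mkcond /=; apply: eq_bigr => k _; rewrite mnm1E.
  by case: eqP.
rewrite (symm_prod_perm (perm_map so_basis pm)).
have sz : size (map so_basis [seq t i | i <- enum 'I_n]) = n.
  by rewrite size_map size_map -cardE card_ord.
rewrite (symm_prod_sizeE sz).
congr (_ *: _); apply: eq_bigr => sigma _; apply: eq_bigr => k _.
by rewrite -map_comp (nth_map (sigma k)) ?size_enum_ord // nth_ord_enum.
Qed.

(** Symmetrization sends the power of a linear function to the power of the
    corresponding element of so_N. *)
Lemma symmetrization_so_lin (B : so) n :
  symmetrization (so_lin B ^+ n) = so_to_U B ^+ n.
Proof.
have U_B : so_to_U B = \sum_k so_coef B k *: so_to_U (so_basis k).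
  by rewrite {1}(so_coefE B) linear_sum; apply: eq_bigr => k _; rewrite linearZ.
pose b (t : {ffun 'I_n -> 'I_(so_dim N)}) := \prod_i so_coef B (t i).
pose u (t : {ffun 'I_n -> 'I_(so_dim N)}) : Uso := \prod_i so_to_U (so_basis (t i)).
rewrite U_B [RHS]presAlg_sum_expn -/u.
have -> : so_lin B ^+ n = \sum_t b t *: \prod_i 'X_(t i).
  rewrite /so_lin -[n in LHS]card_ord -prodr_const bigA_distr_bigA.
  by apply: eq_bigr => t _; rewrite scaler_prod.
rewrite linear_sum /=.
transitivity (n`!%:R^-1 *: \sum_(sigma : 'S_n) \sum_t b t *: u [ffun i => t (sigma i)]).
  rewrite exchange_big scaler_sumr; apply: eq_bigr => t _ /=.
  rewrite linearZ /= symmetrization_prodX scalerA mulrC -scalerA; congr (_ *: _).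
  rewrite scaler_sumr; apply: eq_bigr => sigma _; congr (_ *: _).
  by apply: eq_bigr => i _; rewrite ffunE.
transitivity (n`!%:R^-1 *: \sum_(sigma : 'S_n) \sum_t b t *: u t).
  congr (_ *: _); apply: eq_bigr => sigma _.
  pose h s (t : {ffun 'I_n -> 'I_(so_dim N)}) := [ffun i => t ((s : 'S_n) i)].
  have hK s : cancel (h s) (h s^-1%g).
    by move=> t; apply/ffunP => i; rewrite !ffunE permKV.
  rewrite [RHS](reindex_inj (can_inj (hK sigma))); apply: eq_bigr => t _.
  congr (_ *: _); rewrite /b [LHS](reindex_inj (@perm_inj _ sigma)).
  by apply: eq_bigr => i _; rewrite ffunE.
rewrite sumr_const card_Sn -scaler_nat scalerA mulVf ?scale1r //.
by rewrite pnatr_eq0 -lt0n fact_gt0.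
Qed.
End Symmetrization.

(** * Vector fields on pairs of vectors *)

Section VectorFields.
Variables (M : nat) (R : comNzRingType) (a : 'I_M -> {mpoly R[M]}).
Implicit Types (h k : {mpoly R[M]}).

(** The derivation [sum_i a_i d/dX_i]. *)
Definition vfield h := \sum_i a i * h^`M(i).

Fact vfield_is_linear : linear vfield.
Proof.
move=> c h k; rewrite /vfield scaler_sumr -big_split; apply: eq_bigr => i _ /=.
by rewrite mderivD mderivZ mulrDr scalerAr.
Qed.
HB.instance Definition _ := GRing.isLinear.Build R {mpoly R[M]} {mpoly R[M]} *:%R
  vfield vfield_is_linear.

Lemma vfieldM h k : vfield (h * k) = vfield h * k + h * vfield k.
Proof.
rewrite /vfield mulr_suml mulr_sumr -big_split; apply: eq_bigr => i _ /=.
by rewrite mderivM; ring.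
Qed.

Lemma vfieldX i : vfield 'X_i = a i.
Proof.
rewrite /vfield (bigD1 i) //= big1 => [|j ji]; last first.
  by rewrite mderivU eq_sym (negPf ji) mulr0.
by rewrite mderivU eqxx mulr1 addr0.
Qed.

Lemma vfield1 : vfield 1 = 0.
Proof. by rewrite /vfield big1 // => i _; rewrite -mpolyC1 mderivC mulr0. Qed.

End VectorFields.

Section PairFields.
Variables (N : nat) (F : numFieldType).
Local Notation P := {mpoly F[N + N]}.
Local Notation pvar := (@pvar N F).
Local Notation qvar := (@qvar N F).
Implicit Types (h k : P) (A B : 'M[F]_N).

(** The vector field [(a, b)] on pairs [(p, q)]. *)
Definition pair_field (a b : 'I_N -> P) (i : 'I_(N + N)) : P :=
  match split i with inl j => a j | inr j => b j end.

Lemma pair_fieldE a b h : vfield (pair_field a b) h =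
  \sum_i a i * h^`M(lshift N i) + \sum_i b i * h^`M(rshift N i).
Proof.
rewrite /vfield big_split_ord /=; congr (_ + _); apply: eq_bigr => i _.
  by rewrite /pair_field (unsplitK (inl i)).
by rewrite /pair_field (unsplitK (inr i)).
Qed.

Lemma pair_field_pvar a b i : vfield (pair_field a b) (pvar i) = a i.
Proof. by rewrite vfieldX /pair_field (unsplitK (inl i)). Qed.
Lemma pair_field_qvar a b i : vfield (pair_field a b) (qvar i) = b i.
Proof. by rewrite vfieldX /pair_field (unsplitK (inr i)). Qed.

Lemma pair_field_biform a b A : vfield (pair_field a b) (biform A) =
  \sum_i \sum_j A i j *: (b i * pvar j + qvar i * a j).
Proof.
rewrite /biform raddf_sum; apply: eq_bigr => i _ /=; rewrite raddf_sum.
apply: eq_bigr => j _ /=; rewrite linearZ /= vfieldM.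
by rewrite pair_field_pvar pair_field_qvar.
Qed.

(** The Euler fields in p and in q, the infinitesimal shear [q d/dp], and the
    infinitesimal action of the matrix [A] on both vectors. *)
Definition euler_p : P -> P := vfield (pair_field pvar (fun=> 0)).
Definition euler_q : P -> P := vfield (pair_field (fun=> 0) qvar).
Definition shear : P -> P := vfield (pair_field qvar (fun=> 0)).
Definition rot A : P -> P := vfield (pair_field
  (fun i => \sum_j A i j *: pvar j) (fun i => \sum_j A i j *: qvar j)).

Lemma gauss_mulp i h : gauss (pvar i * h) = gauss h^`M(lshift N i).
Proof. exact: gauss_byparts. Qed.
Lemma gauss_mulq i h : gauss (qvar i * h) = gauss h^`M(rshift N i).
Proof. exact: gauss_byparts. Qed.

Lemma skew_sym_sum A (c : 'I_N -> 'I_N -> F) : A^T = - A ->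
  (forall i j, c i j = c j i) -> \sum_i \sum_j A i j * c i j = 0.
Proof.
move=> skA cs; set S := LHS.
have : S = - S.
  rewrite /S [LHS]exchange_big -sumrN; apply: eq_bigr => i _ /=.
  rewrite -sumrN; apply: eq_bigr => j _; rewrite cs -mulNr; congr (_ * _).
  by have /matrixP/(_ i j) := skA; rewrite !mxE.
by move/eqP; rewrite -addr_eq0 -mulr2n mulrn_eq0 => /eqP.
Qed.

(** The Gaussian law is invariant under rotations. *)
Lemma gauss_rot A h : A^T = - A -> gauss (rot A h) = 0.
Proof.
move=> skA; rewrite /rot pair_fieldE gaussD !gauss_sum.
rewrite [X in X + _ = _](_ : _ = 0) ?[X in _ + X = _](_ : _ = 0) ?addr0 //.
- rewrite -[RHS](skew_sym_sum (c := fun i j =>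
     gauss (h^`M(rshift N i))^`M(rshift N j)) skA); last first.
    by move=> i j; rewrite mderiv_comm.
  apply: eq_bigr => i _; rewrite mulr_suml gauss_sum; apply: eq_bigr => j _.
  by rewrite -scalerAl gaussZ gauss_mulq.
- rewrite -[RHS](skew_sym_sum (c := fun i j =>
     gauss (h^`M(lshift N i))^`M(lshift N j)) skA); last first.
    by move=> i j; rewrite mderiv_comm.
  apply: eq_bigr => i _; rewrite mulr_suml gauss_sum; apply: eq_bigr => j _.
  by rewrite -scalerAl gaussZ gauss_mulp.
Qed.

(** Homogeneous polynomials of degree [d] in the coordinates of the bivector
    [p /\ q], described by differential equations; the second condition only
    serves to bound the degree of [rot A h]. *)
Definition plucker_homog A d h := [/\ h \is (2 * d).-homog, rot A h \is (2 * d).-homog,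
  euler_p h = d%:R *: h, euler_q h = d%:R *: h & shear h = 0].

Lemma plucker_homogM A d e h k : plucker_homog A d h -> plucker_homog A e k ->
  plucker_homog A (d + e) (h * k).
Proof.
move=> [h1 h2 h3 h4 h5] [k1 k2 k3 k4 k5]; rewrite /plucker_homog mulnDr; split.
- exact: dhomogM.
- by rewrite /rot vfieldM; apply: rpredD; apply: dhomogM.
- rewrite /euler_p vfieldM -/euler_p -!/(euler_p _) h3 k3.
  by rewrite -scalerAl -scalerAr -scalerDl natrD.
- rewrite /euler_q vfieldM -!/(euler_q _) h4 k4.
  by rewrite -scalerAl -scalerAr -scalerDl natrD.
- by rewrite /shear vfieldM -!/(shear _) h5 k5 mul0r mulr0 addr0.
Qed.

Lemma plucker_homog1 A : plucker_homog A 0 1.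
Proof.
rewrite /plucker_homog muln0 /rot /euler_p /euler_q /shear !vfield1 !scale0r.
split => //; [exact: dhomog1|exact: rpred0].
Qed.

Lemma plucker_homogZ A d c h : plucker_homog A d h -> plucker_homog A d (c *: h).
Proof.
move=> [h1 h2 h3 h4 h5]; rewrite /plucker_homog /rot /euler_p /euler_q /shear !linearZ /=.
rewrite -!/(rot _ _) -!/(euler_p _) -!/(euler_q _) -!/(shear _) h3 h4 h5 scaler0.
by split; rewrite ?rpredZ //; rewrite !scalerA mulrC.
Qed.

Lemma rot_biform A B : A^T = - A -> rot A (biform B) = biform (B *m A - A *m B).
Proof.
move=> skA; rewrite /rot pair_field_biform.
under eq_bigr => i _ do under eq_bigr => j _ do rewrite scalerDr.
under eq_bigr => i _ do rewrite big_split.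
rewrite big_split /= addrC /biform.
under [RHS]eq_bigr => i _ do under eq_bigr => j _ do
  rewrite mxE [X in _ + X]mxE !mxE scalerDl scaleNr.
under [RHS]eq_bigr => i _ do rewrite big_split sumrN.
rewrite [RHS]big_split sumrN; congr (_ + _).
  apply: eq_bigr => i _.
  under [RHS]eq_bigr => j _ do rewrite scaler_suml.
  rewrite [RHS]exchange_big; apply: eq_bigr => k _ /=.
  rewrite mulr_sumr scaler_sumr; apply: eq_bigr => j _.
  by rewrite -scalerAr scalerA.
rewrite -sumrN.
under [RHS]eq_bigr => i _ do rewrite -sumrN.
rewrite exchange_big [RHS]exchange_big; apply: eq_bigr => j _ /=.
under [RHS]eq_bigr => i _ do rewrite scaler_suml -sumrN.
rewrite [RHS]exchange_big; apply: eq_bigr => k _ /=.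
rewrite mulr_suml scaler_sumr; apply: eq_bigr => i _.
have /matrixP/(_ i k) := skA; rewrite !mxE => ->.
by rewrite -scalerAl scalerA mulrN scaleNr mulrC.
Qed.

Lemma biform_plucker_homog A B : A^T = - A -> B^T = - B -> plucker_homog A 1 (biform B).
Proof.
move=> skA skB; split.
- exact: biform_homog.
- by rewrite rot_biform // biform_homog.
- rewrite /euler_p pair_field_biform scale1r; apply: eq_bigr => i _.
  by apply: eq_bigr => j _; rewrite mul0r add0r.
- rewrite /euler_q pair_field_biform scale1r; apply: eq_bigr => i _.
  by apply: eq_bigr => j _; rewrite mulr0 addr0.
- rewrite /shear pair_field_biform; set S := LHS.
  have : S = - S.
    rewrite /S [LHS]exchange_big -sumrN; apply: eq_bigr => i _ /=.
    rewrite -sumrN; apply: eq_bigr => j _; rewrite !mul0r !add0r (mulrC (qvar j)).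
    rewrite -scaleNr; congr (_ *: _).
    by have /matrixP/(_ i j) := skB; rewrite !mxE.
  move/eqP; rewrite -addr_eq0 -mulr2n -scaler_nat scaler_eq0 pnatr_eq0 /=.
  by move/eqP.
Qed.

Definition normp : P := \sum_i pvar i ^+ 2.
Definition normq : P := \sum_i qvar i ^+ 2.
Definition dotpq : P := \sum_i pvar i * qvar i.
(** The squared area [|p|^2 |q|^2 - (p, q)^2] spanned by p and q. *)
Definition area2 : P := normp * normq - dotpq ^+ 2.

Lemma vfield_normp a b : vfield (pair_field a b) normp = 2%:R *: \sum_i a i * pvar i.
Proof.
rewrite /normp raddf_sum scaler_sumr; apply: eq_bigr => i _ /=.
by rewrite expr2 vfieldM pair_field_pvar mulrC -mulr2n scaler_nat.
Qed.
Lemma vfield_normq a b : vfield (pair_field a b) normq = 2%:R *: \sum_i b i * qvar i.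
Proof.
rewrite /normq raddf_sum scaler_sumr; apply: eq_bigr => i _ /=.
by rewrite expr2 vfieldM pair_field_qvar mulrC -mulr2n scaler_nat.
Qed.
Lemma vfield_dotpq a b : vfield (pair_field a b) dotpq =
  \sum_i a i * qvar i + \sum_i pvar i * b i.
Proof.
rewrite /dotpq raddf_sum -big_split; apply: eq_bigr => i _ /=.
by rewrite vfieldM pair_field_pvar pair_field_qvar.
Qed.

Lemma area2_homog : area2 \is 4.-homog.
Proof.
apply: rpredB; [apply: (@dhomogM _ _ _ 2 _ 2)|apply: (@dhomogMn _ _ _ 2 _ 2)];
  apply: rpred_sum => i _.
- exact: (dhomogMn 2 (pvar_homog _ i)).
- exact: (dhomogMn 2 (qvar_homog _ i)).
- exact: (dhomogM (pvar_homog _ i) (qvar_homog _ i)).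
Qed.

Lemma gauss_normp d h : euler_p h = d%:R *: h ->
  gauss (normp * h) = (N + d)%:R * gauss h.
Proof.
move=> hp; rewrite /normp mulr_suml gauss_sum.
under eq_bigr => i _.
  rewrite expr2 -mulrA gauss_mulp mderivM pvar_dp eqxx mul1r gaussD.
over.
rewrite big_split /= sumr_const card_ord -gauss_sum.
have -> : \sum_i pvar i * h^`M(lshift N i) = euler_p h.
  by rewrite /euler_p pair_fieldE [X in _ + X]big1 ?addr0 // => i _; rewrite mul0r.
by rewrite hp gaussZ natrD mulrDl mulr_natl.
Qed.

Lemma gauss_normq d h : euler_q h = d%:R *: h ->
  gauss (normq * h) = (N + d)%:R * gauss h.
Proof.
move=> hp; rewrite /normq mulr_suml gauss_sum.
under eq_bigr => i _.
  rewrite expr2 -mulrA gauss_mulq mderivM qvar_dq eqxx mul1r gaussD.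
over.
rewrite big_split /= sumr_const card_ord -gauss_sum.
have -> : \sum_i qvar i * h^`M(rshift N i) = euler_q h.
  by rewrite /euler_q pair_fieldE [X in X + _]big1 ?add0r // => i _; rewrite mul0r.
by rewrite hp gaussZ natrD mulrDl mulr_natl.
Qed.

(** Integration by parts in p and q: [|p|^2] and [|q|^2] each contribute
    [N + d], and [(p, q)^2] contributes [N + d] by invariance under the shear. *)
Lemma gauss_area2 A d h : plucker_homog A d h ->
  gauss (area2 * h) = (N + d)%:R * ((N + d)%:R - 1) * gauss h.
Proof.
move=> [_ _ hp hq hs]; rewrite mulrBl gaussB.
have -> : gauss (normp * normq * h) = (N + d)%:R * ((N + d)%:R * gauss h).
  rewrite -mulrA (@gauss_normp d) ?(gauss_normq hq) //.
  rewrite /euler_p vfieldM vfield_normq -!/(euler_p _) hp big1 => [|i _].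
    by rewrite scaler0 mul0r add0r scalerAr.
  by rewrite mul0r.
have -> : gauss (dotpq ^+ 2 * h) = (N + d)%:R * gauss h.
  rewrite expr2 -mulrA {1}/dotpq mulr_suml gauss_sum.
  under eq_bigr => i _ do rewrite -mulrA gauss_mulp mderivM qvar_dp mul0r add0r.
  rewrite -gauss_sum.
  have -> : \sum_i qvar i * (dotpq * h)^`M(lshift N i) = shear (dotpq * h).
    by rewrite /shear pair_fieldE [X in _ + X]big1 ?addr0 // => i _; rewrite mul0r.
  rewrite /shear vfieldM vfield_dotpq -!/(shear _) hs mulr0 addr0.
  rewrite [X in _ + X]big1 ?addr0 => [|i _]; last by rewrite mulr0.
  by rewrite -(gauss_normq hq).
ring.
Qed.

Lemma area2_plucker_homog : plucker_homog 0 2 area2.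
Proof.
split.
- exact: area2_homog.
- rewrite /rot (_ : vfield _ _ = 0) ?rpred0 // pair_fieldE !big1 ?addr0 // => i _;
    by rewrite big1 ?mul0r // => j _; rewrite mxE scale0r.
- rewrite /euler_p raddfB /= [dotpq ^+ 2]expr2 !vfieldM vfield_normp vfield_normq vfield_dotpq.
  rewrite ![\sum_i 0 * _]big1 ?[\sum_i _ * 0]big1 // => [|i _|i _]; rewrite ?mul0r ?mulr0 //.
  rewrite -[\sum_i pvar i * pvar i]/normp -[\sum_i pvar i * qvar i]/dotpq.
  by rewrite scaler0 mulr0 !addr0 -!mul_mpolyC !rmorph_nat /area2; ring.
- rewrite /euler_q raddfB /= [dotpq ^+ 2]expr2 !vfieldM vfield_normp vfield_normq vfield_dotpq.
  rewrite ![\sum_i 0 * _]big1 // => [|i _|i _]; rewrite ?mul0r ?mulr0 //.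
  rewrite -[\sum_i qvar i * qvar i]/normq -[\sum_i pvar i * qvar i]/dotpq.
  by rewrite scaler0 mul0r !add0r -!mul_mpolyC !rmorph_nat /area2; ring.
- rewrite /shear raddfB /= [dotpq ^+ 2]expr2 !vfieldM vfield_normp vfield_normq vfield_dotpq.
  rewrite [\sum_i 0 * _]big1 ?[\sum_i _ * 0]big1 // => [|i _|i _]; rewrite ?mul0r ?mulr0 //.
  rewrite -[\sum_i qvar i * qvar i]/normq.
  have -> : \sum_i qvar i * pvar i = dotpq by apply: eq_bigr => i _; rewrite mulrC.
  by rewrite scaler0 mulr0 !addr0 -!mul_mpolyC !rmorph_nat; ring.
Qed.

Lemma gauss_area2_exp i e h : plucker_homog 0 e.+1 h -> (0 < N)%N ->
  (N + e - 1)`!%:R * gauss (area2 ^+ i * h) =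
  (N + e + 2 * i - 1)`!%:R * gauss h.
Proof.
move=> hh N0; elim: i => [|i IH]; first by rewrite mul1r muln0 addn0.
have hi : plucker_homog 0 (2 * i + e.+1) (area2 ^+ i * h).
  apply: plucker_homogM => //; elim: (i) => [|k IHk]; first exact: plucker_homog1.
  by rewrite exprS mulnS; apply: plucker_homogM area2_plucker_homog IHk.
rewrite exprS -mulrA (gauss_area2 hi) mulrCA IH.
have -> : (N + e + 2 * i.+1 - 1 = (N + e + 2 * i - 1).+2)%N by lia.
rewrite !factS !natrM.
have -> : (N + (2 * i + e.+1))%:R - 1 = (N + e + 2 * i - 1).+1%:R :> F.
  by rewrite -(natrB _ (m := _) (n := 1)) //; [congr (_%:R)|]; lia.
have -> : (N + (2 * i + e.+1) = (N + e + 2 * i - 1).+2)%N by lia.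
ring.
Qed.

End PairFields.

(** * Polynomial forms with values in a presented algebra *)

Lemma mxtrace_bracket (R : comNzRingType) n (A W B : 'M[R]_n) :
  \tr ((A *m W - W *m A) *m B) = \tr (W *m (B *m A - A *m B)).
Proof.
rewrite mulmxBl mulmxBr !linearB /= !mulmxA.
by rewrite -[A *m W *m B]mulmxA (mxtrace_mulC A).
Qed.

Section Forms.
Variables (N : nat) (F : numFieldType) (X : choiceType) (rel : freeAlg F X -> Prop).
Local Notation T := (presAlg rel).
Local Notation so := (so F N).
Local Notation so_basis := (@so_basis F N).
Variable (A : so).
Local Notation pt := ('I_(N + N) -> F).
Local Notation wv v := (wedge (pvec v) (qvec v)).
Implicit Types (G H : pt -> T).

(** [G] is a polynomial function of degree [d] in [p /\ q] with values in [T],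
    and [G'] is its derivative along the rotation field of [A]. *)
Definition plucker_form d G G' := exists (I : finType) (h : I -> {mpoly F[N + N]}) (u : I -> T),
  (forall i, plucker_homog A d (h i)) /\
  (forall v, G v = \sum_i (h i).@[v] *: u i /\
             G' v = \sum_i (rot A (h i)).@[v] *: u i).

Lemma plucker_form1 : plucker_form 0 (fun=> 1) (fun=> 0).
Proof.
exists unit, (fun=> 1), (fun=> 1); split => [_|v]; first exact: plucker_homog1.
rewrite !big_const card_unit /= meval1 scale1r !addr0; split => //.
by rewrite /rot vfield1 meval0 scale0r.
Qed.

Lemma plucker_formD d G G' H H' : plucker_form d G G' -> plucker_form d H H' ->
  plucker_form d (fun v => G v + H v) (fun v => G' v + H' v).
Proof.
move=> [I [h [u [hb hE]]]] [J [k [t [kb kE]]]].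
exists (I + J)%type, (fun i => match i with inl i => h i | inr i => k i end),
  (fun i => match i with inl i => u i | inr i => t i end); split; first by case.
move=> v; rewrite !big_sumType /=.
by have [-> ->] := hE v; have [-> ->] := kE v.
Qed.

Lemma plucker_formM d e G G' H H' : plucker_form d G G' -> plucker_form e H H' ->
  plucker_form (d + e) (fun v => G v * H v) (fun v => G' v * H v + G v * H' v).
Proof.
move=> [I [h [u [hb hE]]]] [J [k [t [kb kE]]]].
exists (I * J)%type, (fun i => h i.1 * k i.2), (fun i => u i.1 * t i.2); split.
  by move=> i; apply: plucker_homogM.
move=> v; have [-> ->] := hE v; have [-> ->] := kE v.
have prodE (f : I -> F) (g : J -> F) : (\sum_i f i *: u i) * (\sum_j g j *: t j) =
    \sum_(i : I * J) (f i.1 * g i.2) *: (u i.1 * t i.2).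
  rewrite big_distrlr pair_big; apply: eq_bigr => -[i j] _ /=.
  by rewrite -presAlg_scalerAl -presAlg_scalerAr scalerA.
split; first by rewrite prodE; apply: eq_bigr => i _; rewrite mevalM.
rewrite !prodE -big_split; apply: eq_bigr => i _ /=.
by rewrite /rot vfieldM mevalD !mevalM scalerDl.
Qed.

Lemma biform_map_eval (B : 'M[F]_N) (v : pt) :
  (biform B).@[v] = ((qvec v)^T *m B *m pvec v) 0 0.
Proof.
rewrite bilinE /biform raddf_sum; apply: eq_bigr => i _ /=; rewrite raddf_sum.
by apply: eq_bigr => j _ /=; rewrite mevalZ mevalM !mevalXU !mxE; ring.
Qed.

(** Linear functions of [p /\ q] have degree one, and the rotation field acts
    on [p /\ q] by the bracket with [A]. *)
Lemma plucker_form_so (L : so -> T) : linear L ->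
  plucker_form 1 (fun v => L (wv v)) (fun v => L (so_bracket A (wv v))).
Proof.
move=> Llin; pose b k := - 2^-1 *: biform (so_basis k : 'M[F]_N).
exists 'I_(so_dim N), b, (fun k => L (so_basis k)); split=> [k|v].
  by apply/plucker_homogZ/biform_plucker_homog; apply: soP.
pose Llin' := GRing.isLinear.Build F so T *:%R L Llin.
pose L' : {linear so -> T} := HB.pack L Llin'.
have LE B : L B = \sum_k so_coef B k *: L (so_basis k).
  rewrite -[LHS]/(L' B) {1}(so_coefE B) linear_sum; apply: eq_bigr => k _.
  by rewrite linearZ.
split; rewrite LE; apply: eq_bigr => k _; congr (_ *: _).
  by rewrite so_coef_wedge /b mevalZ biform_map_eval.
rewrite /b /rot linearZ /= -/(rot _ _) mevalZ rot_biform ?soP // biform_map_eval.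
rewrite /so_coef; congr (_ * _).
rewrite -[_ - _]/(so_mx (so_bracket (so_basis k) A)) -mxtrace_wedge.
exact: mxtrace_bracket.
Qed.

End Forms.

(** * Averaged powers in the enveloping algebra *)

Section FreeInd.
Variables (F : fieldType) (X : choiceType).

(** Induction on the words and on linear combinations of words. *)
Lemma freeAlg_gen_ind (P : freeAlg F X -> Prop) : P 1 ->
  (forall x q, P q -> P (fgen F x * q)) ->
  (forall c p q, P p -> P q -> P (c *: p + q)) -> forall p, P p.
Proof.
move=> P1 Pgen Plin p; rewrite [p]monalgE.
have P0 : P 0 by rewrite -(subrr 1) addrC -scaleN1r; apply: Plin.
elim: (X in \sum_(k <- X) _) => [|k s IH]; first by rewrite big_nil.
rewrite big_cons; set c := (X in mkmalgU _ X).
have -> : (mkmalgU k c : freeAlg F X) = c *: mkmalgU k 1.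
  by rewrite -mul_malgC malgM_def fgmulUU mulr1 monalg.mul1m.
apply: Plin => //; case: k {c} => t; elim: t => [|x t IHt].
  by have -> : FMonom [::] = mone :> {fmonom X} by apply: val_inj; apply: esym; apply: fm1.
have -> : (mkmalgU (FMonom (x :: t)) 1 : freeAlg F X) =
    fgen F x * mkmalgU (FMonom t) 1.
  rewrite malgM_def fgmulUU mulr1; congr mkmalgU.
  by apply: val_inj; apply: etrans (esym (fmM _ _)); rewrite fmuE.
exact: Pgen.
Qed.

Lemma presAlg_central_gen (rel : freeAlg F X -> Prop) (z : presAlg rel) :
  (forall x, z * pgen rel x = pgen rel x * z) -> is_central z.
Proof.
move=> zgen; elim/presAlg_ind; elim/freeAlg_gen_ind => [|x q IH|c p q Hp Hq].
- by rewrite rmorph1 mulr1 mul1r.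
- by rewrite rmorphM mulrA zgen -!mulrA IH.
by rewrite linearP mulrDr mulrDl Hq -presAlg_scalerAr -presAlg_scalerAl Hp.
Qed.

End FreeInd.

Section Expectation.
Variables (F : numFieldType) (N n : nat) (S : finType).
Variables (w : S -> F) (v : S -> 'I_(N + N) -> F).
Hypothesis cub : is_cubature n w v.
Local Notation so := (so F N).
Local Notation B s := (wedge (pvec (v s)) (qvec (v s))).

Lemma cubature_sum (h : {mpoly F[N + N]}) d : h \is d.-homog -> (d <= n)%N ->
  \sum_s w s * h.@[v s] = gauss h.
Proof.
move=> hd dn; rewrite (cub idfun) //.
exact: leq_trans (dhomog_msize_le hd) _.
Qed.

Section Rel.
Variables (X : choiceType) (rel : freeAlg F X -> Prop).

(** The average of an infinitesimal rotation vanishes. *)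
Lemma plucker_form_rot_sum (A : so) d (G G' : _ -> presAlg rel) :
  plucker_form A d G G' -> (2 * d <= n)%N -> \sum_s w s *: G' (v s) = 0.
Proof.
move=> [I [h [u [hb hE]]]] dn.
transitivity (\sum_i (\sum_s w s * (rot A (h i)).@[v s]) *: u i).
  under [RHS]eq_bigr => i _ do rewrite scaler_suml.
  rewrite exchange_big; apply: eq_bigr => s _; have [_ ->] := hE (v s).
  by rewrite scaler_sumr; apply: eq_bigr => i _; rewrite scalerA.
apply: big1 => i _; have [_ rh _ _ _] := hb i.
by rewrite (cubature_sum rh) // gauss_rot ?soP // scale0r.
Qed.

(** In an average, [i] factors [area2] may be traded for a ratio of factorials. *)
Lemma plucker_form_area_sum e i (G G' : _ -> presAlg rel) : (0 < N)%N ->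
  plucker_form 0 e.+1 G G' -> (2 * e.+1 + 4 * i <= n)%N ->
  (N + e - 1)`!%:R *: \sum_s (w s * (area2 N F).@[v s] ^+ i) *: G (v s) =
  (N + e + 2 * i - 1)`!%:R *: \sum_s w s *: G (v s).
Proof.
move=> N0 [I [h [u [hb hE]]]] dn.
have GE k : (4 * k + 2 * e.+1 <= n)%N ->
    \sum_s (w s * (area2 N F).@[v s] ^+ k) *: G (v s) =
    \sum_j gauss (area2 N F ^+ k * h j) *: u j.
  move=> kn; transitivity
    (\sum_j (\sum_s w s * (area2 N F ^+ k * h j).@[v s]) *: u j).
    under [RHS]eq_bigr => j _ do rewrite scaler_suml.
    rewrite exchange_big; apply: eq_bigr => s _; have [-> _] := hE (v s).
    rewrite scaler_sumr; apply: eq_bigr => j _.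
    by rewrite scalerA mevalM rmorphXn mulrA.
  apply: eq_bigr => j _; have [hj _ _ _ _] := hb j.
  by rewrite (cubature_sum (dhomogM (dhomogMn k (area2_homog N F)) hj)).
rewrite (GE i); last by rewrite addnC.
have := GE 0 _; rewrite muln0 => GE0.
transitivity ((N + e + 2 * i - 1)`!%:R *: \sum_j gauss (h j) *: u j).
  rewrite !scaler_sumr; apply: eq_bigr => j _; rewrite !scalerA.
  by rewrite (gauss_area2_exp i (hb j)).
congr (_ *: _); transitivity (\sum_s (w s * (area2 N F).@[v s] ^+ 0) *: G (v s)).
  rewrite GE0 ?(leq_trans _ dn) ?leq_addr //.
  by apply: eq_bigr => j _; rewrite mul1r.
by apply: eq_bigr => s _; rewrite mulr1.
Qed.
End Rel.

(** The average of [B^k], for [B] the rank-two element of the pair [(p, q)]. *)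
Definition avg_pow k : Uso F N := \sum_s w s *: so_to_U (B s) ^+ k.

Lemma plucker_form_pow (A : so) k : plucker_form A k
  (fun v => so_to_U (wedge (pvec v) (qvec v)) ^+ k)
  (fun v => so_to_U A * so_to_U (wedge (pvec v) (qvec v)) ^+ k -
            so_to_U (wedge (pvec v) (qvec v)) ^+ k * so_to_U A).
Proof.
have base := plucker_form_so A (@so_to_U_linear F N).
elim: k => [|k IH].
  have [I [h [u [hb hE]]]] := plucker_form1 (@U_rel F N) A.
  exists I, h, u; split => // v'; have [/= h1 h0] := hE v'; split; first by rewrite -h1.
  by rewrite -h0 expr0 mulr1 mul1r subrr.
have [I [h [u [hb hE]]]] := plucker_formM IH base; rewrite addn1 in hb.
exists I, h, u; split => // v'; have [/= e1 e2] := hE v'.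
by rewrite -e1 -e2 -so_to_U_bracket exprSr commutator_Mr.
Qed.

(** Averages of powers are invariant under so_N, hence central. *)
Lemma avg_pow_central k : (2 * k <= n)%N -> is_central (avg_pow k).
Proof.
move=> kn; apply: presAlg_central_gen => A; apply/eqP; rewrite eq_sym -subr_eq0.
rewrite -[pgen _ A]/(so_to_U A) /avg_pow mulr_sumr mulr_suml -sumrB.
rewrite -[X in _ == X](plucker_form_rot_sum (plucker_form_pow A k) kn); apply/eqP.
apply: eq_bigr => s _.
by rewrite scalerBr presAlg_scalerAr presAlg_scalerAl.
Qed.

Lemma symm_det_coef j : (4 * j <= n)%N ->
  symmetrization (det_coef F N j) = (2 * j)`!%:R^-1 *: avg_pow (2 * j).
Proof.
move=> jn; rewrite (det_coef_cubature cub jn) linear_sum /avg_pow scaler_sumr.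
apply: eq_bigr => s _; rewrite linearZ /= symmetrization_so_lin scalerA.
by rewrite mulrC.
Qed.

Lemma so_r_cubature j x y : (4 * j + 4 <= n)%N ->
  so_r j x y = - \sum_s (w s / (2 * j).+1`!%:R * (x^T *m B s *m y) 0 0) *:
        so_to_U (B s) ^+ (2 * j).+1.
Proof.
move=> jn; rewrite /so_r (so_gamma_cubature cub x y jn).
rewrite -[LHS]/(_ (- _)) (raddfN (@symmetrization F N)); congr (- _).
rewrite (raddf_sum (@symmetrization F N)); apply: eq_bigr => s _.
by rewrite /= symmetrizationZ symmetrization_so_lin.
Qed.

End Expectation.

(** * Commutation of powers with vectors *)

(** Pascal's rule for sums over the powers of two commuting shift operators. *)
Lemma binomial_step (F : fieldType) (V : lmodType F) (eps : F) (g : nat -> nat -> V) n :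
  \sum_(i < n.+1) (eps ^+ i * 'C(n, i)%:R) *: (g (n - i).+1 i + eps *: g (n - i)%N i.+1) =
  \sum_(i < n.+2) (eps ^+ i * 'C(n.+1, i)%:R) *: g (n.+1 - i)%N i.
Proof.
rewrite [RHS]big_ord_recl bin0 subn0.
under [X in _ = _ + X]eq_bigr => i _ do
  rewrite lift0 binS natrD mulrDr scalerDl subSS exprSr.
rewrite [X in _ = _ + X]big_split /= [X in _ = _ + (X + _)]big_ord_recr /=.
rewrite bin_small // mulr0 scale0r addr0 addrA.
have -> : (eps ^+ 0 * 1%:R) *: g n.+1 0 +
   \sum_(i < n) (eps ^+ i * eps * 'C(n, i.+1)%:R) *: g (n - i)%N i.+1 =
   \sum_(i < n.+1) (eps ^+ i * 'C(n, i)%:R) *: g (n - i).+1 i.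
  rewrite [RHS]big_ord_recl bin0 subn0; congr (_ + _); apply: eq_bigr => i _.
  by rewrite lift0 -subSn // exprSr.
rewrite -big_split; apply: eq_bigr => i _ /=.
by rewrite scalerDr scalerA mulrAC.
Qed.

Section HeckeAlgebra.
Variables (F : numFieldType) (N m : nat) (zeta : m.+1.-tuple F).
Local Notation so := (so F N).
Local Notation H := (Hso N zeta).
Local Notation U_to_H := (@U_to_H F N m zeta).
Local Notation V_to_H := (@V_to_H F N m zeta).
Implicit Types (x y z : 'cV[F]_N) (u : Uso F N) (A B : so).

Lemma U_to_H_linear : linear U_to_H.
Proof. by move=> c u u'; apply: presAlg_rel_lin (H_rel_Ulin zeta c u u'). Qed.
HB.instance Definition _ := GRing.isLinear.Build F (Uso F N) H *:%R
  U_to_H U_to_H_linear.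

Lemma U_to_HZ c u : U_to_H (c *: u) = c *: U_to_H u.
Proof. exact: linearZ_LR. Qed.

Lemma U_to_H_monoid : monoid_morphism U_to_H.
Proof.
split=> [|u u']; last exact: presAlg_rel_mul (H_rel_UM zeta u u').
by rewrite -(rmorph1 (presAlg_pi (H_rel zeta))); apply: presAlg_relE (H_rel_U1 N zeta).
Qed.
HB.instance Definition _ := GRing.isMonoidMorphism.Build (Uso F N) H
  U_to_H U_to_H_monoid.

Lemma V_to_H_linear : linear V_to_H.
Proof. by move=> c x y; apply: presAlg_rel_lin (H_rel_Vlin zeta c x y). Qed.
HB.instance Definition _ := GRing.isLinear.Build F 'cV[F]_N H *:%R
  V_to_H V_to_H_linear.

Definition so_to_H A : H := U_to_H (so_to_U A).

Lemma so_to_H_linear : linear so_to_H.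
Proof. by move=> c A B; rewrite /so_to_H so_to_U_linear U_to_H_linear. Qed.

Lemma so_to_H_act A x : so_to_H A * V_to_H x - V_to_H x * so_to_H A = V_to_H (A *m x).
Proof. exact: presAlg_rel_comm (H_rel_act zeta A x). Qed.

Lemma V_to_H_comm x y : V_to_H x * V_to_H y - V_to_H y * V_to_H x =
  U_to_H (\sum_(j < m.+1) zeta`_j *: so_r j x y).
Proof. exact: presAlg_rel_comm (H_rel_comm zeta x y). Qed.

(** [(L + R)^d] applied to [x], for the left and right multiplications [L] and
    [R] by [A]. *)
Fixpoint anti_pow A x (d : nat) : H :=
  if d is d'.+1 then so_to_H A * anti_pow A x d' + anti_pow A x d' * so_to_H A
  else V_to_H x.

Lemma anti_powZ A c x d : anti_pow A (c *: x) d = c *: anti_pow A x d.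
Proof.
elim: d => [|d IH] /=; first by rewrite linearZ.
by rewrite IH scalerDr presAlg_scalerAr presAlg_scalerAl.
Qed.

Lemma anti_pow_comm A x d :
  so_to_H A * anti_pow A x d - anti_pow A x d * so_to_H A = anti_pow A (A *m x) d.
Proof.
elim: d => [|d IH] /=; first exact: so_to_H_act.
by rewrite -IH (commutator_Ml (so_to_H A) (anti_pow A x d)).
Qed.

(** The iterates [A^i x], which are the images of [x] under [(L - R)^i]. *)
Definition iter_so A x i := iter i (mulmx A) x.

(** [2 L = (L + R) + (L - R)] raised to the power [n]. *)
Lemma mul_pow_anti A x n : (2 ^+ n : F) *: (so_to_H A ^+ n * V_to_H x) =
  \sum_(i < n.+1) (1 ^+ i * 'C(n, i)%:R) *: anti_pow A (iter_so A x i) (n - i).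
Proof.
elim: n => [|n IH].
  by rewrite big_ord1 !expr0 bin0 !mul1r !scale1r.
rewrite -(binomial_step 1 (fun d i => anti_pow A (iter_so A x i) d)).
rewrite exprS -scalerA exprS -mulrA presAlg_scalerAr IH mulr_sumr scaler_sumr.
apply: eq_bigr => i _; set c := (X in _ = X *: _).
rewrite -presAlg_scalerAr [LHS]scalerA [_ * c]mulrC -[LHS]scalerA; congr (_ *: _).
rewrite scale1r /= -anti_pow_comm scaler_nat mulr2n.
by rewrite [RHS]addrACA subrr addr0.
Qed.

(** [2 R = (L + R) - (L - R)] raised to the power [n]. *)
Lemma mul_anti_pow A x n : (2 ^+ n : F) *: (V_to_H x * so_to_H A ^+ n) =
  \sum_(i < n.+1) ((-1) ^+ i * 'C(n, i)%:R) *: anti_pow A (iter_so A x i) (n - i).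
Proof.
elim: n => [|n IH].
  by rewrite big_ord1 !expr0 bin0 !mulr1 !scale1r.
rewrite -(binomial_step (-1) (fun d i => anti_pow A (iter_so A x i) d)).
rewrite exprS -scalerA exprSr mulrA presAlg_scalerAl IH mulr_suml scaler_sumr.
apply: eq_bigr => i _; set c := (X in _ = X *: _).
rewrite -presAlg_scalerAl [LHS]scalerA [_ * c]mulrC -[LHS]scalerA; congr (_ *: _).
rewrite scaleN1r /= -anti_pow_comm scaler_nat mulr2n opprB.
by rewrite [RHS]addrC addrA subrK.
Qed.

(** [B^3 = - (a/2)^2 B], where [a] is the area spanned by p and q. *)
Lemma wedge_cube p q x (A := wedge p q) (dot := fun a b : 'cV[F]_N => (a^T *m b) 0 0) :
  A *m (A *m (A *m x)) =
  - (4^-1 * (dot p p * dot q q - dot p q ^+ 2)) *: (A *m x).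
Proof.
have Az z : A *m z = 2^-1 *: (dot q z *: p - dot p z *: q).
  rewrite /A /= -scalemxAl mulmxBl -!mulmxA [q^T *m z]mx11_scalar.
  by rewrite [p^T *m z]mx11_scalar !mul_mx_scalar.
have dotC a b : dot a b = dot b a.
  by rewrite /dot !mxE; apply: eq_bigr => i _; rewrite !mxE mulrC.
have Ap : A *m (A *m p) = - (4^-1 * (dot p p * dot q q - dot p q ^+ 2)) *: p.
  rewrite (Az p) -scalemxAr mulmxBr -!scalemxAr !Az (dotC q p).
  by apply/matrixP => a b; rewrite !mxE; field.
have Aq : A *m (A *m q) = - (4^-1 * (dot p p * dot q q - dot p q ^+ 2)) *: q.
  rewrite (Az q) -scalemxAr mulmxBr -!scalemxAr !Az (dotC q p).
  by apply/matrixP => a b; rewrite !mxE; field.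
rewrite [in LHS](Az x) -scalemxAr mulmxBr -!scalemxAr.
rewrite mulmxBr -!scalemxAr Ap Aq (Az x).
by apply/matrixP => a b; rewrite !mxE; ring.
Qed.

End HeckeAlgebra.

(** * Averaged commutators and anticommutators *)

Lemma area2_eval (N : nat) (F : numFieldType) (v : 'I_(N + N) -> F) :
  (area2 N F).@[v] = ((pvec v)^T *m pvec v) 0 0 * ((qvec v)^T *m qvec v) 0 0 -
     ((pvec v)^T *m qvec v) 0 0 ^+ 2.
Proof.
rewrite /area2 /normp /normq /dotpq mevalB mevalM rmorphXn !raddf_sum /= !mxE.
congr (_ * _ - _ ^+ 2); apply: eq_bigr => i _;
  by rewrite ?rmorphXn ?mevalM /= !mevalXU !mxE.
Qed.

Section Moments.
Variables (F : numFieldType) (N m : nat) (zeta : m.+1.-tuple F) (n : nat).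
Variables (S : finType) (w : S -> F) (v : S -> 'I_(N + N) -> F).
Hypothesis cub : is_cubature n w v.
Hypothesis N0 : (0 < N)%N.
Variable y : 'cV[F]_N.
Local Notation H := (Hso N zeta).
Local Notation V_to_H := (@V_to_H F N m zeta).
Local Notation B s := (wedge (pvec (v s)) (qvec (v s))).
Local Notation anti_pow := (@anti_pow F N m zeta).
Local Notation so_to_H := (@so_to_H F N m zeta).

Lemma plucker_form_anti_pow d : exists G', plucker_form 0 d.+1
  (fun v' => anti_pow (wedge (pvec v') (qvec v')) (wedge (pvec v') (qvec v') *m y) d) G'.
Proof.
have base : exists G', plucker_form 0 1 (fun v' => so_to_H (wedge (pvec v') (qvec v'))) G'.
  by eexists; apply: plucker_form_so; apply: so_to_H_linear.
elim: d => [|d [G' IH]].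
  eexists; apply: (@plucker_form_so N F _ _ 0 (fun A : so F N => V_to_H (A *m y))).
  by move=> c A A'; rewrite mulmxDl -scalemxAl V_to_H_linear.
have [b' bP] := base; eexists.
have l := plucker_formM bP IH; have r := plucker_formM IH bP.
by rewrite addn1 in r; apply: plucker_formD l r.
Qed.

(** The average of [(L + R)^d] applied to [B y], normalized so that the effect of
    factors [area2] depends on the total degree only; see [moment_odd]. *)
Definition moment d : H :=
  (N + d - 1)`!%:R^-1 *: \sum_s w s *: anti_pow (B s) (B s *m y) d.

Lemma iter_so_odd s l : iter_so (B s) y (2 * l).+1 =
  (- 4^-1 * (area2 N F).@[v s]) ^+ l *: (B s *m y).
Proof.
elim: l => [|l IH]; first by rewrite muln0 expr0 scale1r.
have -> : (2 * l.+1 = (2 * l).+2)%N by lia.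
rewrite -[LHS]/(B s *m (B s *m iter_so (B s) y (2 * l).+1)) IH -!scalemxAr.
by rewrite wedge_cube -area2_eval scalerA exprSr mulNr.
Qed.

Lemma moment_odd l d : (2 * d.+1 + 4 * l <= n)%N ->
  \sum_s w s *: anti_pow (B s) (iter_so (B s) y (2 * l).+1) d =
  ((- 4^-1) ^+ l * (N + d + 2 * l - 1)`!%:R) *: moment d.
Proof.
move=> dn; have [G' GP] := plucker_form_anti_pow d.
have f0 : (N + d - 1)`!%:R != 0 :> F by rewrite pnatr_eq0 -lt0n fact_gt0.
have := plucker_form_area_sum cub N0 GP dn; rewrite /moment; set S0 := (X in _ = _ *: X) => E.
transitivity (((- 4^-1) ^+ l / (N + d - 1)`!%:R) *: ((N + d + 2 * l - 1)`!%:R *: S0)).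
  rewrite -E scalerA divfK // scaler_sumr.
  apply: eq_bigr => s _; rewrite iter_so_odd anti_powZ !scalerA exprMn.
  by congr (_ *: _); ring.
by rewrite !scalerA; congr (_ *: _); ring.
Qed.

Variable K : nat.
(** The linear map taking [X^e] to [moment e], truncated to degrees below [K]. *)
Definition moment_fun (f : {poly F}) : H := \sum_(e < K) f`_e *: moment e.

Fact moment_fun_is_linear : linear moment_fun.
Proof.
move=> c f g; rewrite /moment_fun scaler_sumr -big_split; apply: eq_bigr => e _ /=.
by rewrite coefD coefZ scalerDl scalerA.
Qed.
HB.instance Definition _ := GRing.isLinear.Build F {poly F} H *:%R
  moment_fun moment_fun_is_linear.

Lemma moment_funD f g : moment_fun (f + g) = moment_fun f + moment_fun g.
Proof. exact: raddfD. Qed.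

Lemma moment_funZ a f : moment_fun (a *: f) = a *: moment_fun f.
Proof. exact: linearZ_LR. Qed.

Lemma moment_fun_sum I (r : seq I) (P : pred I) (f : I -> {poly F}) :
  moment_fun (\sum_(i <- r | P i) f i) = \sum_(i <- r | P i) moment_fun (f i).
Proof. exact: raddf_sum. Qed.

Lemma moment_fun_expD c k : (k < K)%N -> moment_fun (('X + c%:P) ^+ k) =
  \sum_(i < k.+1) (c ^+ i * 'C(k, i)%:R) *: moment (k - i).
Proof.
move=> kK; rewrite exprDn raddf_sum; apply: eq_bigr => i _ /=.
rewrite -polyC_exp -mulr_natr -polyC_natr -mulrA -polyCM mulrC mul_polyC.
rewrite linearZ /=; congr (_ *: _).
have ki : (k - i < K)%N by apply: leq_ltn_trans kK; apply: leq_subr.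
rewrite /moment_fun (bigD1 (Ordinal ki)) //= coefXn eqxx scale1r big1 ?addr0 // => e.
by rewrite -val_eqE /= coefXn => /negPf ->; rewrite scale0r.
Qed.

Variable c : F.
Hypothesis c2 : c ^+ 2 = - 4^-1.

(** The powers of [c] absorb the factors [-1/4] coming from [wedge_cube]; the
    even terms of the binomial expansions cancel. *)
Lemma moment_diff k : (2 * k <= n)%N -> (k < K)%N ->
  (c * 2 ^+ k) *: \sum_s w s *: (so_to_H (B s) ^+ k * V_to_H y -
                               V_to_H y * so_to_H (B s) ^+ k) =
  (N + k - 2)`!%:R *: moment_fun (('X + c%:P) ^+ k - ('X - c%:P) ^+ k).
Proof.
move=> kn kK; rewrite -polyCN linearB /= !moment_fun_expD // -sumrB !scaler_sumr.
transitivity (\sum_(i < k.+1) (c * ((1 - (-1) ^+ i) * 'C(k, i)%:R)) *: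
   \sum_s w s *: anti_pow (B s) (iter_so (B s) y i) (k - i)).
  under [RHS]eq_bigr => i _ do rewrite scaler_sumr.
  rewrite [RHS]exchange_big; apply: eq_bigr => s _ /=.
  rewrite [LHS]scalerA [c * _ * _]mulrAC -[LHS]scalerA scalerBr.
  rewrite (mul_pow_anti zeta (B s) y k) (mul_anti_pow zeta (B s) y k) -sumrB scaler_sumr.
  apply: eq_bigr => i _; rewrite -scalerBl [LHS]scalerA [RHS]scalerA.
  congr (_ *: _); rewrite expr1n; move: ((-1) ^+ i) ('C(k, i)%:R) => e b; ring.
apply: eq_bigr => i _; case: (boolP (odd i)) => oi; last first.
  have e0 : 1 - (-1) ^+ i = 0 :> F by rewrite -signr_odd (negPf oi) subrr.
  have eN : (- c) ^+ i = c ^+ i by rewrite exprNn -signr_odd (negPf oi) mul1r.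
  by rewrite e0 eN -scalerBl subrr mul0r mulr0 !scale0r scaler0.
have iE : nat_of_ord i = (2 * i./2).+1 by have := odd_double_half i; rewrite oi; lia.
have ik : (i <= k)%N by rewrite -ltnS.
have dn : (2 * (k - i).+1 + 4 * i./2 <= n)%N by lia.
have MO := moment_odd dn; rewrite -iE in MO; rewrite MO.
have -> : (N + (k - i) + 2 * i./2 - 1 = N + k - 2)%N by lia.
rewrite -scalerBl [LHS]scalerA [RHS]scalerA; congr (_ *: _).
have eN : (- c) ^+ i = - c ^+ i by rewrite exprNn -signr_odd oi expr1 mulN1r.
have ci : c ^+ i = c * (- 4^-1) ^+ i./2 by rewrite {1}iE exprS exprM c2.
have ei : (-1) ^+ i = -1 :> F by rewrite -signr_odd oi.
rewrite eN ci ei; move: ((- 4^-1) ^+ _) (_`!%:R) ('C(_, _)%:R) => f g b; ring.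
Qed.

Lemma moment_sum k : (2 * k.+1 <= n)%N -> (k < K)%N ->
  2 ^+ k *: \sum_s w s *: (so_to_H (B s) ^+ k * V_to_H (B s *m y) +
                               V_to_H (B s *m y) * so_to_H (B s) ^+ k) =
  (N + k - 1)`!%:R *: moment_fun (('X + c%:P) ^+ k + ('X - c%:P) ^+ k).
Proof.
move=> kn kK; rewrite -polyCN moment_funD !moment_fun_expD //.
have -> : \sum_(i < k.+1) (c ^+ i * 'C(k, i)%:R) *: moment (k - i) +
    \sum_(i < k.+1) ((- c) ^+ i * 'C(k, i)%:R) *: moment (k - i) =
    \sum_(i < k.+1) ((c ^+ i + (- c) ^+ i) * 'C(k, i)%:R) *: moment (k - i).
  by rewrite -big_split; apply: eq_bigr => i _ /=; rewrite mulrDl scalerDl.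
rewrite !scaler_sumr.
transitivity (\sum_(i < k.+1) ((1 + (-1) ^+ i) * 'C(k, i)%:R) *:
   \sum_s w s *: anti_pow (B s) (iter_so (B s) y i.+1) (k - i)).
  under [RHS]eq_bigr => i _ do rewrite scaler_sumr.
  rewrite [RHS]exchange_big; apply: eq_bigr => s _.
  rewrite [LHS]scalerA [_ * w s]mulrC -[LHS]scalerA scalerDr.
  rewrite (mul_pow_anti zeta (B s) _ k) (mul_anti_pow zeta (B s) _ k).
  rewrite scalerDr !scaler_sumr -big_split; apply: eq_bigr => i _.
  have -> : iter_so (B s) y i.+1 = iter_so (B s) (B s *m y) i by exact: iterSr.
  set M := anti_pow _ _ _.
  transitivity ((w s * (1 ^+ i * 'C(k, i)%:R)) *: M +
    (w s * ((-1) ^+ i * 'C(k, i)%:R)) *: M); last first.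
    rewrite -scalerDl [RHS]scalerA; congr (_ *: _).
    by rewrite expr1n; move: ((-1) ^+ i) ('C(k, i)%:R) => e b; ring.
  by rewrite -[(w s * (1 ^+ i * _)) *: M]scalerA -[(w s * ((-1) ^+ i * _)) *: M]scalerA.
apply: eq_bigr => i _; case: (boolP (odd i)) => oi.
  have e0 : 1 + (-1) ^+ i = 0 :> F by rewrite -signr_odd oi expr1 subrr.
  have eN : (- c) ^+ i = - c ^+ i by rewrite exprNn -signr_odd oi expr1 mulN1r.
  by rewrite e0 eN subrr !mul0r !scale0r scaler0.
have iE : nat_of_ord i = (2 * i./2)%N.
  by have := odd_double_half i; rewrite (negPf oi); lia.
have ik : (i <= k)%N by rewrite -ltnS.
have dn : (2 * (k - i).+1 + 4 * i./2 <= n)%N by lia.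
have MO := moment_odd dn; rewrite -iE in MO; rewrite MO.
have -> : (N + (k - i) + i - 1 = N + k - 1)%N by lia.
rewrite [LHS]scalerA [RHS]scalerA; congr (_ *: _).
have eN : (- c) ^+ i = c ^+ i by rewrite exprNn -signr_odd (negPf oi) mul1r.
have ci : c ^+ i = (- 4^-1) ^+ i./2 by rewrite {1}iE exprM c2.
have ei : (-1) ^+ i = 1 :> F by rewrite -signr_odd (negPf oi).
rewrite eN ci ei; move: ((- 4^-1) ^+ _) (_`!%:R) ('C(_, _)%:R) => f g b; ring.
Qed.


End Moments.

(** * A shift identity for polynomials *)

Section ShiftIdentity.
Variables (K : numFieldType) (a : nat -> K) (m : nat) (c : K).
Hypothesis c2 : c ^+ 2 = - 4^-1.

(** The combinations of the [a j] that occur in the recursion for [zeta] and in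
    the definition of [g]. *)
Definition zcoef j : K := \sum_(1 <= l < m.+2 - j)
  (-1) ^+ (l + 1) * 'C(2 * j + 2 * l, 2 * l - 1)%:R * a (j + l - 1).
Definition gcoef j : K := - 2 * a (j - 1) + \sum_(1 <= l < m.+2 - j)
  (-1) ^+ (l + 1) * 'C(2 * j + 2 * l, 2 * l)%:R * a (j + l - 1).

Let P : {poly K} := \sum_(1 <= M < m.+2) a (M - 1) *: 'X^(2 * M).
Let sh (e : K) : {poly K} := 'X + e%:P.
Let e := 2 * c.

Lemma coef_shift_exp (d : K) n k : (sh d ^+ n)`_k = 'C(n, k)%:R * d ^+ (n - k).
Proof.
rewrite /sh exprDn coef_sum.
under eq_bigr => i _ do rewrite -polyC_exp coefMn coefMC coefXn.
have [kn|nk] := leqP k n; last first.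
  rewrite bin_small // mul0r big1 // => i _.
  by rewrite (_ : (k == n - i)%N = false) ?mul0r ?mul0rn //; apply/eqP; lia.
rewrite (bigD1 (inord (n - k))) //= inordK ?ltnS ?leq_subr // subKn // eqxx mul1r.
rewrite big1 ?addr0 => [|i]; first by rewrite -bin_sub ?leq_subr // subKn // mulr_natl.
rewrite -val_eqE /= inordK ?ltnS ?leq_subr // => ik.
by rewrite (_ : (k == n - i)%N = false) ?mul0r ?mul0rn //; apply/eqP; move: (ltn_ord i) ik; lia.
Qed.

Lemma coef_shift_P (d : K) k : (P \Po sh d)`_k =
  \sum_(1 <= M < m.+2) a (M - 1) * ('C(2 * M, k)%:R * d ^+ (2 * M - k)).
Proof.
rewrite /P raddf_sum coef_sum; apply: eq_bigr => M _ /=.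
by rewrite comp_polyZ coefZ comp_Xn_poly coef_shift_exp.
Qed.

Lemma sum_shift (f : nat -> K) j :
  \sum_(j.+1 <= M < m.+2) f M = \sum_(1 <= l < m.+2 - j) f (j + l)%N.
Proof. by rewrite -[j.+1]add1n big_addn; apply: eq_bigr => l _; rewrite addnC. Qed.

Lemma sum_shift_index (f : nat -> K) j : (j <= m.+1)%N ->
  (forall M, (M <= j)%N -> (0 < M)%N -> f M = 0) ->
  \sum_(1 <= M < m.+2) f M = \sum_(1 <= l < m.+2 - j) f (j + l)%N.
Proof.
move=> jm f0; rewrite (big_cat_nat (n := j.+1)) //= -sum_shift.
by rewrite big_nat big1 ?add0r // => M /andP[M0 Mj]; apply: f0.
Qed.

Lemma sum_shift_from (f : nat -> K) j : (0 < j <= m.+1)%N ->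
  (forall M, (M < j)%N -> (0 < M)%N -> f M = 0) ->
  \sum_(1 <= M < m.+2) f M = f j + \sum_(1 <= l < m.+2 - j) f (j + l)%N.
Proof.
case/andP=> j0 jm f0; rewrite (big_cat_nat (n := j)) //=; last by lia.
rewrite big_nat big1 ?add0r => [|M /andP[M0 Mj]]; last exact: f0.
by rewrite big_ltn ?ltnS // sum_shift.
Qed.

Let e2 : e ^+ 2 = -1.
Proof. by rewrite /e exprMn c2; field. Qed.

(** The odd polynomial with coefficients [zcoef] is a difference of shifts of
    [P]. *)
Lemma zcoef_shift : (2 * e) *: \sum_(j < m.+1) zcoef j *: 'X^(2 * j + 1) =
  (P \Po sh e) - (P \Po sh (- e)).
Proof.
apply/polyP => k; rewrite coefZ coefB !coef_shift_P -sumrB coef_sum.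
under eq_bigr => j _ do rewrite coefZ coefXn.
case: (boolP (odd k && (k <= 2 * m + 1)%N)) => [/andP[ok km]|nk].
  have kE : k = (2 * k./2 + 1)%N by have := odd_double_half k; rewrite ok; lia.
  move: kE; set j := k./2 => kE; have jm : (j < m.+1)%N by lia.
  rewrite (bigD1 (Ordinal jm)) //= big1 => [|i]; last first.
    rewrite -val_eqE /= => ij; rewrite (_ : (k == _) = false) ?mulr0 //.
    by apply/eqP; lia.
  rewrite {1}kE eqxx mulr1 addr0 (@sum_shift_index _ j) ?(ltnW jm) //; last first.
    by move=> M Mj M0; rewrite bin_small ?mul0r ?mulr0 ?subrr //; lia.
  rewrite mulr_sumr !big_nat; apply: eq_bigr => l /andP[l1 lm].
  have -> : (2 * (j + l) - k = (2 * l.-1).+1)%N by lia.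
  have -> : 'C(2 * (j + l), k) = 'C(2 * j + 2 * l, 2 * l - 1).
    by rewrite -mulnDr -bin_sub; [congr 'C(_, _)|]; lia.
  rewrite [(- e) ^+ _]exprNn [(-1) ^+ (2 * _).+1]exprS !exprM sqrrN expr1n.
  rewrite expr1n !mulr1 exprS exprM e2.
  have -> : (-1) ^+ (l + 1) = (-1) ^+ l.-1 :> K.
    by rewrite (_ : l + 1 = l.-1 + 2)%N ?exprD ?sqrrN ?expr1n ?mulr1 //; lia.
  ring.
rewrite big1 ?mulr0 => [|j _]; last first.
  rewrite (_ : (k == _) = false) ?mulr0 //; apply/eqP => kE; move: nk (ltn_ord j).
  by rewrite kE oddD oddM /=; lia.
rewrite big_nat big1 // => M /andP[M1 Mm].
have [kM|Mk] := leqP k (2 * M); last by rewrite bin_small // !mul0r mulr0 subrr.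
have -> : (2 * M - k = 2 * (M - k./2))%N.
  by move: nk; have := odd_double_half k; case: (odd k) => /=; lia.
by rewrite !exprM sqrrN subrr.
Qed.

Lemma coefP k : P`_k =
  \sum_(1 <= M < m.+2) a (M - 1) * (k == 2 * M)%N%:R.
Proof. by rewrite coef_sum; apply: eq_bigr => M _; rewrite coefZ coefXn. Qed.

(** The even polynomial with coefficients [gcoef] is, up to a constant,
    [- P] minus the mean of two shifts of [P]. *)
Lemma gcoef_shift : exists C0 : K,
  2 *: \sum_(1 <= j < m.+2) gcoef j *: 'X^(2 * j) =
  C0%:P - (2 *: P + ((P \Po sh e) + (P \Po sh (- e)))).
Proof.
pose Q := 2 *: P + ((P \Po sh e) + (P \Po sh (- e))).
exists Q`_0; rewrite -/Q; apply/polyP => k; rewrite coefB coefC coefZ coef_sum.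
under eq_bigr => j _ do rewrite coefZ coefXn.
have [->|k0] := eqVneq k 0%N.
  rewrite subrr big_nat big1 ?mulr0 // => j /andP[j1 _].
  by rewrite (_ : (0 == _)%N = false) ?mulr0 //; apply/eqP; lia.
rewrite sub0r /Q !coefD !coefZ !coef_shift_P coefP -big_split /=.
have dneg (f : nat -> K) : (forall M, (0 < M)%N -> (k != 2 * M)%N) ->
    \sum_(1 <= M < m.+2) f M * (k == 2 * M)%N%:R = 0.
  move=> kM; rewrite big_nat big1 // => M /andP[M1 _].
  by rewrite (negPf (kM M M1)) mulr0.
case: (boolP (odd k)) => ok.
  have kM M : (0 < M)%N -> (k != 2 * M)%N.
    by move=> _; apply/eqP => kE; move: ok; rewrite kE oddM.
  rewrite !dneg // !mulr0 add0r big_nat big1 ?oppr0 // => M /andP[M1 Mm].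
  have [kM'|Mk] := leqP k (2 * M); last by rewrite bin_small // !mul0r mulr0 addr0.
  have -> : (2 * M - k = (2 * (M - k./2.+1)).+1)%N.
    by have := odd_double_half k; rewrite ok /=; lia.
  by rewrite [(- e) ^+ _]exprS [e ^+ _]exprS !exprM sqrrN mulNr mulrN mulrN subrr.
have kE : k = (2 * k./2)%N by have := odd_double_half k; rewrite (negPf ok); lia.
move: kE; set j := k./2 => kE; have j0 : (0 < j)%N by lia.
have [jm|mj] := leqP j m.+1; last first.
  rewrite !big_nat !big1 ?mulr0 ?addr0 ?oppr0 // => M /andP[M1 Mm].
  - by rewrite bin_small ?mul0r ?mulr0 ?addr0 //; lia.
  - by rewrite (_ : (k == _)%N = false) ?mulr0 //; apply/eqP; lia.
  - by rewrite (_ : (k == _)%N = false) ?mulr0 //; apply/eqP; lia.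
have pick (f : nat -> K) : \sum_(1 <= M < m.+2) f M * (k == 2 * M)%N%:R = f j.
  rewrite (@sum_shift_from _ j) ?j0 //; last first.
    by move=> M Mj M0; rewrite (_ : (k == _)%N = false) ?mulr0 //; apply/eqP; lia.
  rewrite {1}kE eqxx mulr1 big_nat big1 ?addr0 // => l /andP[l1 _].
  by rewrite (_ : (k == _)%N = false) ?mulr0 //; apply/eqP; lia.
rewrite !pick (@sum_shift_from _ j) ?j0 //; last first.
  by move=> M Mj M0; rewrite bin_small ?mul0r ?mulr0 ?addr0 //; lia.
rewrite {1 2 3 4}kE binn subnn !expr0 /gcoef.
set T := \sum_(_ <= _ < _) _; set T' := \sum_(_ <= _ < _) _.
have -> : T' = - (2 * T); last by ring.
rewrite /T /T' mulr_sumr -sumrN !big_nat; apply: eq_bigr => l /andP[l1 lm].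
have -> : (2 * (j + l) - k = 2 * l)%N by lia.
have -> : 'C(2 * (j + l), k) = 'C(2 * j + 2 * l, 2 * l).
  by rewrite -mulnDr -bin_sub; [congr 'C(_, _)|]; lia.
by rewrite !exprM sqrrN e2 exprD expr1; ring.
Qed.

(** The shifts by [3 c], [c], [- c], [- 3 c] of [P] cancel in pairs. *)
Lemma shift_identity :
  \sum_(1 <= j < m.+2) gcoef j *: (('X + c%:P) ^+ (2 * j) - ('X - c%:P) ^+ (2 * j)) +
  e *: \sum_(j < m.+1) zcoef j *:
    (('X + c%:P) ^+ (2 * j + 1) + ('X - c%:P) ^+ (2 * j + 1)) = 0.
Proof.
have [C0 gE] := gcoef_shift; have zE := zcoef_shift.
set G := \sum_(1 <= j < m.+2) _ in gE; set Z := \sum_(j < m.+1) _ in zE.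
have GE d : G \Po sh d = \sum_(1 <= j < m.+2) gcoef j *: sh d ^+ (2 * j).
  rewrite raddf_sum; apply: eq_bigr => j _ /=.
  by rewrite comp_polyZ comp_Xn_poly.
have ZE d : Z \Po sh d = \sum_(j < m.+1) zcoef j *: sh d ^+ (2 * j + 1).
  rewrite raddf_sum; apply: eq_bigr => j _ /=.
  by rewrite comp_polyZ comp_Xn_poly.
transitivity ((G \Po sh c) - (G \Po sh (- c)) +
   e *: ((Z \Po sh c) + (Z \Po sh (- c)))).
  rewrite !GE !ZE -sumrB -big_split /=; congr (_ + _ *: _).
    by apply: eq_bigr => j _; rewrite -scalerBr /sh polyCN.
  by apply: eq_bigr => j _; rewrite -scalerDr /sh polyCN.
have n2 : (2 : K) != 0 by rewrite pnatr_eq0.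
apply: (scalerI n2); rewrite scaler0 scalerDr scalerA scalerBr -!comp_polyZ.
rewrite gE scalerDr -!comp_polyZ zE !(comp_polyB, comp_polyD, comp_polyZ, comp_polyC).
have shA d f : (P \Po sh d) \Po sh f = P \Po sh (d + f).
  by rewrite -comp_polyA /sh comp_polyD comp_polyX comp_polyC addrAC -addrA -polyCD (addrC d).
rewrite !shA.
have -> : e - c = c by rewrite /e; ring.
have -> : - e + c = - c by rewrite /e; ring.
rewrite -!mul_polyC; ring.
Qed.

End ShiftIdentity.

(** * The sum of squares of an orthonormal basis *)

Section Orthonormal.
Variables (F : numFieldType) (N : nat) (x : 'I_N -> 'cV[F]_N).
Hypothesis hx : orthonormal_family x.

Lemma orthonormal_expand (z : 'cV[F]_N) :
  \sum_i ((x i)^T *m z) 0 0 *: x i = z.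
Proof.
pose X : 'M[F]_N := \matrix_(a, i) x i a 0.
have XX : X^T *m X = 1%:M.
  apply/matrixP => i j; rewrite !mxE -(hx i j) mxE; apply: eq_bigr => k _.
  by rewrite !mxE.
apply/matrixP => a b; rewrite (ord1 b) summxE -[in RHS](mul1mx z) -(mulmx1C XX).
rewrite -mulmxA [RHS]mxE; apply: eq_bigr => i _; rewrite !mxE mulrC; congr (_ * _).
by apply: eq_bigr => k _; rewrite !mxE.
Qed.

Variables (m : nat) (zeta : m.+1.-tuple F).
Local Notation V_to_H := (@V_to_H F N m zeta).
Local Notation U_to_H := (@U_to_H F N m zeta).
Local Notation so_to_H := (@so_to_H F N m zeta).
Let t1 : Hso N zeta := \sum_i V_to_H (x i) ^+ 2.

Lemma V_to_H_expand (z : 'cV[F]_N) :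
  V_to_H z = \sum_i ((x i)^T *m z) 0 0 *: V_to_H (x i).
Proof.
rewrite -{1}(orthonormal_expand z) linear_sum; apply: eq_bigr => i _.
by rewrite linearZ.
Qed.

Lemma square_sum_so_comm (A : so F N) : t1 * so_to_H A = so_to_H A * t1.
Proof.
apply/eqP; rewrite eq_sym -subr_eq0; apply/eqP.
rewrite /t1 mulr_sumr mulr_suml -sumrB.
pose q i j := ((x j)^T *m A *m x i) 0 0.
have qN i j : q i j = - q j i.
  by have := skew_quad (x j) (x i) 0 (soP A); rewrite muln0 add0n expr1.
transitivity (\sum_i \sum_j q i j *: (V_to_H (x j) * V_to_H (x i)) +
              \sum_i \sum_j q i j *: (V_to_H (x i) * V_to_H (x j))).
  rewrite -big_split; apply: eq_bigr => i _.
  have -> : so_to_H A * V_to_H (x i) ^+ 2 - V_to_H (x i) ^+ 2 * so_to_H A =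
     V_to_H (A *m x i) * V_to_H (x i) + V_to_H (x i) * V_to_H (A *m x i).
    by rewrite -so_to_H_act expr2 commutator_Mr.
  rewrite (V_to_H_expand (A *m x i)) mulr_suml mulr_sumr; congr (_ + _).
    by apply: eq_bigr => j _; rewrite -presAlg_scalerAl mulmxA.
  by apply: eq_bigr => j _; rewrite -presAlg_scalerAr mulmxA.
rewrite [X in _ + X]exchange_big -big_split big1 // => i _.
rewrite -big_split big1 // => j _ /=.
by rewrite (qN i j) scaleNr addNr.
Qed.

Lemma square_sum_U_comm (u : Uso F N) : t1 * U_to_H u = U_to_H u * t1.
Proof.
elim/presAlg_ind: u; elim/freeAlg_gen_ind => [|A q IH|c p q Hp Hq].
- have -> : U_to_H (presAlg_pi (@U_rel F N) 1) = 1 by exact: rmorph1.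
  by rewrite mulr1 mul1r.
- have -> : U_to_H (presAlg_pi (@U_rel F N) (fgen F A * q)) =
      so_to_H A * U_to_H (presAlg_pi (@U_rel F N) q) by exact: (etrans (congr1 U_to_H (rmorphM _ _ _)) (rmorphM U_to_H _ _)).
  by rewrite mulrA square_sum_so_comm -!mulrA IH.
have -> : U_to_H (presAlg_pi (@U_rel F N) (c *: p + q)) =
    c *: U_to_H (presAlg_pi (@U_rel F N) p) + U_to_H (presAlg_pi (@U_rel F N) q).
  by rewrite -U_to_H_linear; congr U_to_H; apply: linearP.
by rewrite mulrDr mulrDl Hq -presAlg_scalerAr -presAlg_scalerAl Hp.
Qed.

Lemma square_sum_V_comm (y : 'cV[F]_N) :
  t1 * V_to_H y - V_to_H y * t1 =
  \sum_i (V_to_H (x i) * U_to_H (\sum_(j < m.+1) zeta`_j *: so_r j (x i) y) +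
          U_to_H (\sum_(j < m.+1) zeta`_j *: so_r j (x i) y) * V_to_H (x i)).
Proof.
rewrite /t1 mulr_suml mulr_sumr -sumrB; apply: eq_bigr => i _.
by rewrite -V_to_H_comm commutator_sqr.
Qed.

Section Cub.
Variables (n : nat) (S : finType) (w : S -> F) (v : S -> 'I_(N + N) -> F).
Hypothesis cub : is_cubature n w v.
Local Notation B s := (wedge (pvec (v s)) (qvec (v s))).

(** The averages of [[B^k, y]] and of [{B^k, B y}]. *)
Definition avg_comm (y : 'cV[F]_N) k : Hso N zeta := \sum_s w s *:
  (so_to_H (B s) ^+ k * V_to_H y - V_to_H y * so_to_H (B s) ^+ k).
Definition avg_anticomm (y : 'cV[F]_N) k : Hso N zeta := \sum_s w s *:
  (so_to_H (B s) ^+ k * V_to_H (B s *m y) + V_to_H (B s *m y) * so_to_H (B s) ^+ k).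

Lemma U_to_H_avg_pow k : U_to_H (avg_pow w v k) = \sum_s w s *: so_to_H (B s) ^+ k.
Proof.
rewrite /avg_pow (raddf_sum U_to_H); apply: eq_bigr => s _ /=.
by rewrite U_to_HZ rmorphXn.
Qed.

Lemma avg_pow_V_comm y k :
  U_to_H (avg_pow w v k) * V_to_H y - V_to_H y * U_to_H (avg_pow w v k) = avg_comm y k.
Proof.
rewrite U_to_H_avg_pow mulr_suml mulr_sumr -sumrB; apply: eq_bigr => s _.
by rewrite scalerBr presAlg_scalerAl presAlg_scalerAr.
Qed.

(** Summing [(x_i, B y) x_i] over the orthonormal basis gives [B y]. *)
Lemma square_sum_V_avg y : (4 * m + 4 <= n)%N ->
  t1 * V_to_H y - V_to_H y * t1 =
  - \sum_(j < m.+1) (zeta`_j / (2 * j).+1`!%:R) *: avg_anticomm y (2 * j).+1.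
Proof.
move=> mn; rewrite square_sum_V_comm.
pose b k s := so_to_H (B s) ^+ k.
have rE i : U_to_H (\sum_(j < m.+1) zeta`_j *: so_r j (x i) y) =
   - \sum_(j < m.+1) \sum_s (zeta`_j / (2 * j).+1`!%:R * w s *
       ((x i)^T *m (B s *m y)) 0 0) *: b (2 * j).+1 s.
  rewrite (raddf_sum U_to_H) -sumrN; apply: eq_bigr => j _ /=.
  have jn : (4 * j + 4 <= n)%N by have := ltn_ord j; lia.
  rewrite (so_r_cubature cub _ _ jn) scalerN scaler_sumr (raddfN U_to_H) (raddf_sum U_to_H).
  congr (- _); apply: eq_bigr => s _ /=.
  rewrite scalerA U_to_HZ rmorphXn mulmxA; congr (_ *: _); ring.
transitivity (- \sum_i \sum_(j < m.+1) \sum_s (zeta`_j / (2 * j).+1`!%:R * w s *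
    ((x i)^T *m (B s *m y)) 0 0) *:
    (b (2 * j).+1 s * V_to_H (x i) + V_to_H (x i) * b (2 * j).+1 s)).
  rewrite -sumrN; apply: eq_bigr => i _; rewrite rE mulrN mulNr -opprD; congr (- _).
  rewrite mulr_suml mulr_sumr -big_split; apply: eq_bigr => j _.
  rewrite mulr_suml mulr_sumr -big_split; apply: eq_bigr => s _.
  by rewrite -presAlg_scalerAl -presAlg_scalerAr [RHS]scalerDr [RHS]addrC.
congr (- _); rewrite exchange_big; apply: eq_bigr => j _ /=.
rewrite exchange_big scaler_sumr; apply: eq_bigr => s _ /=.
rewrite scalerA (V_to_H_expand (B s *m y)) mulr_suml mulr_sumr -big_split scaler_sumr.
apply: eq_bigr => i _.
rewrite -[in RHS]presAlg_scalerAl -[in RHS]presAlg_scalerAr.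
transitivity ((zeta`_j / (2 * j).+1`!%:R * w s) *: (((x i)^T *m (B s *m y)) 0 0 *:
   (b (2 * j).+1 s * V_to_H (x i) + V_to_H (x i) * b (2 * j).+1 s))).
  by rewrite [RHS]scalerA.
by rewrite [X in _ *: X = _]scalerDr.
Qed.
End Cub.
End Orthonormal.

Section CentralV.
Variables (F : numFieldType) (N m : nat) (zeta : m.+1.-tuple F).
Hypothesis hN : (0 < N)%N.
Variable x : 'I_N -> 'cV[F]_N.
Hypothesis hx : orthonormal_family x.
Variables (n : nat) (S : finType) (w : S -> F) (v : S -> 'I_(N + N) -> F).
Hypothesis cub : is_cubature n w v.
Hypothesis mn : (4 * m + 4 <= n)%N.
Variable c : F.
Hypothesis c2 : c ^+ 2 = - 4^-1.
Variables (a g : nat -> F) (k : F).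
Hypothesis gE : forall j, (0 < j)%N -> g j * (N + 2 * j - 2)`!%:R =
  k * (2 * j)`!%:R * 2 ^+ (2 * j) * gcoef a m j.
Hypothesis zE : forall j, (j <= m)%N -> zeta`_j * (N + 2 * j)`!%:R =
  - k * (2 * j).+1`!%:R * 2 ^+ (2 * j).+2 * zcoef a m j.
Local Notation V_to_H := (@V_to_H F N m zeta).
Local Notation U_to_H := (@U_to_H F N m zeta).
Let t1 : Hso N zeta := \sum_i V_to_H (x i) ^+ 2.
Let C : Uso F N :=
  \sum_(1 <= j < m.+2) (g j / (2 * j)`!%:R) *: avg_pow w v (2 * j).

Lemma scaled_avg_comm y K j : (0 < j <= m.+1)%N -> (2 * j < K)%N ->
  c *: ((g j / (2 * j)`!%:R) *: avg_comm zeta w v y (2 * j)) =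
  k *: moment_fun zeta w v y K
    (gcoef a m j *: (('X + c%:P) ^+ (2 * j) - ('X - c%:P) ^+ (2 * j))).
Proof.
case/andP=> j0 jm jK; have jn : (2 * (2 * j) <= n)%N by lia.
have p0 : 2 ^+ (2 * j) != 0 :> F by rewrite expf_neq0 // pnatr_eq0.
have f0 : (2 * j)`!%:R != 0 :> F by rewrite pnatr_eq0 -lt0n fact_gt0.
have H := moment_diff zeta cub hN y c2 jn jK.
transitivity ((g j / (2 * j)`!%:R / 2 ^+ (2 * j)) *:
    ((c * 2 ^+ (2 * j)) *: avg_comm zeta w v y (2 * j))).
  rewrite [LHS]scalerA [RHS]scalerA; congr (_ *: _).
  by move: p0 f0; move: (2 ^+ _) (_`!%:R) => p f p1 f1; field; rewrite p1 f1.
apply: etrans (congr1 _ H) _; rewrite moment_funZ [LHS]scalerA [RHS]scalerA; congr (_ *: _).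
transitivity (g j * (N + 2 * j - 2)`!%:R / (2 * j)`!%:R / 2 ^+ (2 * j)).
  by rewrite mulrAC [_ / _ * _]mulrAC.
rewrite gE //.
by move: p0 f0; move: (2 ^+ _) (_`!%:R) => p f p1 f1; field; rewrite p1 f1.
Qed.

Lemma scaled_avg_anticomm y K j : (j <= m)%N -> ((2 * j).+1 < K)%N ->
  c *: ((zeta`_j / (2 * j).+1`!%:R) *: avg_anticomm zeta w v y (2 * j).+1) =
  - k *: moment_fun zeta w v y K (2 * c *: (zcoef a m j *:
      (('X + c%:P) ^+ (2 * j + 1) + ('X - c%:P) ^+ (2 * j + 1)))).
Proof.
move=> jm jK; have jn : (2 * (2 * j).+2 <= n)%N by lia.
have p0 : 2 ^+ (2 * j).+1 != 0 :> F by rewrite expf_neq0 // pnatr_eq0.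
have f0 : (2 * j).+1`!%:R != 0 :> F by rewrite pnatr_eq0 -lt0n fact_gt0.
have H := moment_sum zeta cub hN y c2 jn jK.
transitivity ((c * (zeta`_j / (2 * j).+1`!%:R / 2 ^+ (2 * j).+1)) *:
    (2 ^+ (2 * j).+1 *: avg_anticomm zeta w v y (2 * j).+1)).
  rewrite [LHS]scalerA [RHS]scalerA; congr (_ *: _).
  by move: p0 f0; move: (2 ^+ _) (_`!%:R) => p f p1 f1; field; rewrite p1 f1.
apply: etrans (congr1 _ H) _; rewrite [2 * c *: _]scalerA moment_funZ [LHS]scalerA [RHS]scalerA addn1.
have -> : (N + (2 * j).+1 - 1 = N + 2 * j)%N by lia.
congr (_ *: _).
transitivity (c * (zeta`_j * (N + 2 * j)`!%:R / (2 * j).+1`!%:R / 2 ^+ (2 * j).+1)).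
  by rewrite -mulrA; congr (_ * _); rewrite mulrAC [_ / _ * _]mulrAC.
rewrite zE // exprS.
by move: p0 f0; move: (2 ^+ _) (_`!%:R) => p f p1 f1; field; rewrite p1 f1.
Qed.

(** The commutators of [y] with the two summands cancel, by [shift_identity].
    The hypotheses on [g] and [zeta] express them through one sequence [a] with
    a common factor [k]. *)
Lemma square_sum_central_V (y : 'cV[F]_N) :
  (t1 + U_to_H C) * V_to_H y = V_to_H y * (t1 + U_to_H C).
Proof.
have EC : U_to_H C * V_to_H y - V_to_H y * U_to_H C =
    \sum_(1 <= j < m.+2) (g j / (2 * j)`!%:R) *: avg_comm zeta w v y (2 * j).
  rewrite /C (raddf_sum U_to_H) mulr_suml mulr_sumr -sumrB.
  apply: eq_bigr => j _ /=; rewrite U_to_HZ -(avg_pow_V_comm zeta w v y) scalerBr.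
  by congr (_ - _); [rewrite presAlg_scalerAl|rewrite presAlg_scalerAr].
have Et := square_sum_V_avg hx zeta cub y mn.
suff E0 : (U_to_H C * V_to_H y - V_to_H y * U_to_H C) +
     (t1 * V_to_H y - V_to_H y * t1) = 0.
  rewrite (mulrDl t1) (mulrDr (V_to_H y)).
  apply: subr0_eq; rewrite -[RHS]E0 opprD addrACA; exact: addrC.
have c0 : c != 0.
  apply: contraTneq isT => cz; move/eqP: c2.
  by rewrite cz expr0n /= eq_sym oppr_eq0 invr_eq0 pnatr_eq0.
apply: (scalerI c0); rewrite scaler0 EC Et scalerBr.
pose K := (2 * m + 3)%N; pose Lam := moment_fun zeta w v y K.
rewrite !scaler_sumr.
have -> : \sum_(1 <= j < m.+2)
    c *: ((g j / (2 * j)`!%:R) *: avg_comm zeta w v y (2 * j)) =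
    k *: Lam (\sum_(1 <= j < m.+2) gcoef a m j *:
      (('X + c%:P) ^+ (2 * j) - ('X - c%:P) ^+ (2 * j))).
  rewrite /Lam moment_fun_sum scaler_sumr; apply: eq_big_nat => j jP.
  by apply: scaled_avg_comm => //; rewrite /K; lia.
have -> : \sum_(j < m.+1)
    c *: ((zeta`_j / (2 * j).+1`!%:R) *: avg_anticomm zeta w v y (2 * j).+1) =
    - k *: Lam (2 * c *: \sum_(j < m.+1) zcoef a m j *:
      (('X + c%:P) ^+ (2 * j + 1) + ('X - c%:P) ^+ (2 * j + 1))).
  rewrite [X in Lam X]scaler_sumr /Lam moment_fun_sum scaler_sumr; apply: eq_bigr => j _.
  by apply: scaled_avg_anticomm; have := ltn_ord j; rewrite /K; lia.
rewrite scaleNr opprK -scalerDr.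
have LamD f f' : Lam f + Lam f' = Lam (f + f') by rewrite /Lam moment_funD.
by rewrite LamD shift_identity // /Lam raddf0 scaler0.
Qed.

End CentralV.

(** * The constants *)

Section Constants.
Variables (R : realType) (N : nat).

(** The power of pi in [const_mu], which does not depend on [s]. *)
Definition kappa : R :=
  exp.powR trigo.pi (N%:R - 2^-1) / exp.powR trigo.pi 2^-1.

Lemma const_muE s : const_mu R N s =
  kappa * (s + 1)`!%:R * 2 ^+ (s + N + 1) / (s + N - 1)`!%:R.
Proof.
rewrite /const_mu /const_omega /kappa.
have p0 : exp.powR trigo.pi 2^-1 != 0 :> R.
  by rewrite gt_eqF // exp.powR_gt0 // trigo.pi_gt0.
have f0 : (s + N - 1)`!%:R != 0 :> R by rewrite pnatr_eq0 -lt0n fact_gt0.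
have t0 : 2 ^+ (s + N + 1) != 0 :> R by rewrite expf_neq0 // pnatr_eq0.
by field; rewrite t0 p0 f0.
Qed.

Variables (m : nat) (zeta : m.+1.-tuple R[i]).
Local Notation F := R[i].

Lemma residue_g_poly : residue N (g_poly N zeta) =
  \sum_(1 <= j < m.+2) g_seq N zeta j *: det_coef F N j.
Proof.
set g := g_poly N zeta.
have coefg k : g`_k = if (1 <= k < m.+2)%N then g_seq N zeta k else 0.
  rewrite /g /g_poly coef_sum; case: ifP => kP.
    rewrite (bigD1_seq k) ?mem_index_iota ?iota_uniq //= coefZ coefXn eqxx mulr1.
    rewrite big1 ?addr0 // => j jk.
    by rewrite coefZ coefXn eq_sym (negPf jk) mulr0.
  rewrite big_nat big1 // => j jP; rewrite coefZ coefXn.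
  by case: eqP => [kj|]; rewrite ?mulr0 //; rewrite kj jP in kP.
have sg : (size g <= m.+2)%N.
  apply/leq_sizeP => k mk; rewrite coefg ifN //.
  by apply/negP => /andP[_]; rewrite ltnNge mk.
rewrite /residue -(big_mkord xpredT (fun j => g`_j *: det_coef F N j)).
transitivity (\sum_(0 <= j < m.+2) g`_j *: det_coef F N j).
  rewrite [RHS](big_cat_nat (n := size g)) //= [X in _ + X]big_nat [X in _ + X]big1 ?addr0 //.
  by move=> j /andP[gj _]; rewrite nth_default // scale0r.
rewrite big_ltn // coefg scale0r add0r; apply: eq_big_nat => j jP.
by rewrite coefg jP.
Qed.

Lemma g_seqE j : (0 < j)%N -> g_seq N zeta j * (N + 2 * j - 2)`!%:R =
  (2 ^+ N.+1 * kappa)%:C%C * (2 * j)`!%:R * 2 ^+ (2 * j) * gcoef (a_seq N zeta) m j.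
Proof.
move=> j0; rewrite /g_seq -/(gcoef (a_seq N zeta) m j).
rewrite const_muE.
have -> : (2 * j - 1 + 1 = 2 * j)%N by lia.
have -> : (2 * j - 1 + N + 1 = 2 * j + N)%N by lia.
have -> : (2 * j - 1 + N - 1 = N + 2 * j - 2)%N by lia.
have f0 : (N + 2 * j - 2)`!%:R != 0 :> F by rewrite pnatr_eq0 -lt0n fact_gt0.
move: kappa => k.
rewrite !rmorphM fmorphV !rmorph_nat !rmorphXn !rmorph_nat exprD exprS.
by field.
Qed.

Lemma zetaE j : (j <= m)%N -> zeta`_j * (N + 2 * j)`!%:R =
  - (2 ^+ N.+1 * kappa)%:C%C * (2 * j).+1`!%:R * 2 ^+ (2 * j).+2 *
    zcoef (a_seq N zeta) m j.
Proof.
move=> jm; rewrite (a_seqP N zeta jm) -/(zcoef (a_seq N zeta) m j).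
rewrite /const_nu const_muE.
have -> : (2 * j + 1 + 1 = (2 * j).+2)%N by lia.
have -> : (2 * j + 1 + N + 1 = (2 * j).+2 + N)%N by lia.
have -> : (2 * j + 1 + N - 1 = N + 2 * j)%N by lia.
have f0 : (N + 2 * j)`!%:R != 0 :> F by rewrite pnatr_eq0 -lt0n fact_gt0.
have n0 : (2 * j).+2%:R != 0 :> F by rewrite pnatr_eq0.
rewrite factS natrM [2 ^+ (_ + N)]exprD [2 ^+ N.+1]exprS.
move: kappa (2 * j).+2 n0 => k n2 n0.
rewrite !(rmorphM, rmorphN, fmorphV, rmorph_nat, rmorphXn) .
by field; rewrite n0 f0.
Qed.

End Constants.

Section Central.
Variables (R : realType) (N m : nat) (zeta : m.+1.-tuple R[i]).
Local Notation F := R[i].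
Variables (n : nat) (S : finType) (w : S -> F) (v : S -> 'I_(N + N) -> F).
Hypothesis cub : is_cubature n w v.
Hypothesis mn : (4 * m + 4 <= n)%N.
Let C : Uso F N := symmetrization (residue N (g_poly N zeta)).

Lemma symm_residueE : C =
  \sum_(1 <= j < m.+2) (g_seq N zeta j / (2 * j)`!%:R) *: avg_pow w v (2 * j).
Proof.
rewrite /C residue_g_poly (raddf_sum (@symmetrization F N)).
apply: eq_big_nat => j jP /=; rewrite symmetrizationZ.
by rewrite (symm_det_coef cub) ?scalerA //; lia.
Qed.

Lemma symm_residue_central : is_central C.
Proof.
move=> u; rewrite symm_residueE mulr_suml mulr_sumr; apply: eq_big_nat => j jP.
rewrite -presAlg_scalerAl -presAlg_scalerAr; congr (_ *: _).
by apply: (avg_pow_central cub); lia.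
Qed.

End Central.

Theorem theorem6p1 (R : realType) (N m : nat) (hN : (3 <= N)%N)
  (zeta : m.+1.-tuple R[i]) (x : 'I_N -> 'cV[R[i]]_N) (hx : orthonormal_family x) :
  let C : Uso R[i] N := symmetrization (residue N (g_poly N zeta)) in
  let t1 : Hso N zeta := \sum_(i < N) V_to_H zeta (x i) ^+ 2 in
  is_central C /\ is_central (t1 + U_to_H zeta C).
Proof.
(* No polynomial of degree above 4 m + 4 in (p, q) is averaged. *)
have [S [w [v cub]]] := gauss_cubature R[i] (4 * m + 4) (N + N).
have N0 : (0 < N)%N by apply: leq_trans hN.
move=> C t1; have Cc : is_central C by exact: (symm_residue_central zeta cub (leqnn _)).
split=> //; apply: presAlg_central_gen => -[u|y]; last first.
  (* The constant 'i / 2 is a square root of -1/4. *)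
  have c2 : ('i / 2) ^+ 2 = - 4^-1 :> R[i].
    by rewrite expr_div_n sqrCi -natrX mulN1r.
  rewrite /C (symm_residueE zeta cub (leqnn _)).
  apply: (square_sum_central_V N0 hx cub (leqnn _) c2).
    by move=> j; apply: g_seqE.
  by move=> j; apply: zetaE.
rewrite -[pgen _ _]/(U_to_H zeta u) (mulrDl t1) (mulrDr (U_to_H zeta u)).
congr (_ + _); first exact: square_sum_U_comm.
apply: etrans (esym (rmorphM _ C u)) _.
by rewrite Cc; apply: (rmorphM (@U_to_H _ N m zeta)).
Qed.
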